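(* The elliptic function $d$ has a pole at $\frac{2}{3} i K'$.
   Context: Fix $0 < k < 1$. Let $u = \int_0^{\sin \phi} F(\frac{1}{3}, \frac{2}{3} ; \frac{1}{2} ; k^2 t^2) \, \frac{{\rm d} t}{\sqrt{1 - t^2}}$, where $F = {}_2F_1$ is the Gauss hypergeometric function; near the origin this inverts to $u \mapsto \phi(u)$ with $\phi(0)=0$, and $d(u) = \phi'(u) = 1/F(\frac{1}{3}, \frac{2}{3} ; \frac{1}{2} ; k^2 \sin^2 \phi(u))$. The function $d$ extends to the elliptic function $d = 1 - \frac{4}{9} k^2 (\wp + \frac{1}{3})^{-1}$, where $\wp$ is the Weierstrass function with invariants $g_2 = \frac{4}{27}(9 - 8k^2)$ and $g_3 = \frac{8}{27^2}(8k^4 - 36k^2 + 27)$. Since $0<k<1$, $\wp$ has real invariants and positive discriminant, so its period lattice is rectangular; $2K$ and $2 i K'$ (with $K > 0$, $K' > 0$) denote fundamental periods of $\wp$ (and hence of $d$). *)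

(* Defs.v *)
From mathcomp Require Import all_boot all_order all_algebra.
From mathcomp Require Import all_classical all_reals all_analysis.
From mathcomp Require Import complex.
Set Implicit Arguments. Unset Strict Implicit. Unset Printing Implicit Defensive.
Import Order.TTheory GRing.Theory Num.Theory.
Import numFieldNormedType.Exports.
Local Open Scope ring_scope.
Local Open Scope classical_set_scope.
Local Open Scope complex_scope.

(* The complex numbers over a real closed field, seen as a numClosedFieldType,
   so that MathComp-Analysis' generic topology / normed structure applies. *)
Definition Cx (R : rcfType) : numClosedFieldType := R[i].

Definition lattice_square_sum (R : realType) (w1 w2 : Cx R)
    (F : Cx R -> Cx R) (N : nat) : Cx R :=
  \sum_(i < (N.*2).+1) \sum_(j < (N.*2).+1)
    (let om := ((i%:Z - N%:Z)%:~R * w1 + (j%:Z - N%:Z)%:~R * w2 : Cx R) in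
     if om == 0 then 0 else F om).

(* Lattice sum  Sum'_{omega in Lambda} F(omega), as the limit of square partial sums
   (all the sums used below are absolutely convergent, so this is the usual sum). *)
Definition lattice_sum (R : realType) (w1 w2 : Cx R) (F : Cx R -> Cx R) : Cx R :=
  lim (lattice_square_sum w1 w2 F n @[n --> \oo]).

Definition wp (R : realType) (w1 w2 : Cx R) (z : Cx R) : Cx R :=
  (z ^+ 2)^-1 + lattice_sum w1 w2 (fun om => ((z - om) ^+ 2)^-1 - (om ^+ 2)^-1).

Definition wp_g2 (R : realType) (w1 w2 : Cx R) : Cx R :=
  60 * lattice_sum w1 w2 (fun om => (om ^+ 4)^-1).
Definition wp_g3 (R : realType) (w1 w2 : Cx R) : Cx R :=
  140 * lattice_sum w1 w2 (fun om => (om ^+ 6)^-1).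

Definition has_pole (R : realType) (f : Cx R -> Cx R) (z0 : Cx R) : Prop :=
  forall M : R, \forall z \near z0^', (M%:C : Cx R) <= `|f z|.

(* Main.v *)
(* Liouville's theorem for doubly periodic functions gives p'' = 6 p^2 - g2/2 and
   p'^2 = 4 p^3 - g2 p - g3 for the Weierstrass function p. Let a = 2iK'/3, a third of a
   period. The function p(z) p(z+a) p(z-a) - p(a)^2 (p(z) + p(z+a) + p(z-a)) has a as an
   additional period and its pole at 0 cancels, so it is constant; its expansion at 0 then
   yields p''(a)^2 = 12 p(a) p'(a)^2. On a rectangular lattice p(a) is real and p'(a) is
   purely imaginary, hence p(a) <= 0. Eliminating p'(a) and p''(a) shows that p(a) is a
   root of the 3-division polynomial, which for the given g2 and g3 is X + 1/3 times a
   cubic without roots X <= 0, so p(a) = -1/3. Since the discriminant is nonzero,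
   p'(a) <> 0, and p + 1/3 has an isolated zero at a.
   Cauchy's theory is avoided: Liouville's theorem follows from a maximum principle that
   only needs a second-order Taylor expansion at every point, and the expansions of the
   lattice sums are obtained term by term. *)

Require Import Defs.
From mathcomp Require Import all_boot all_order all_algebra.
From mathcomp Require Import all_classical all_reals all_analysis.
From mathcomp Require Import complex.
From mathcomp Require Import ring lra zify.
Import Order.TTheory GRing.Theory Num.Theory.
Import numFieldNormedType.Exports.
Local Open Scope ring_scope.
Local Open Scope classical_set_scope.
Local Open Scope complex_scope.

Set Implicit Arguments.
Unset Strict Implicit.
Unset Printing Implicit Defensive.

(** The function p(z) p(z+a) p(z-a) - ... replaces the duplication formula: p(2a) = p(-a) = p(a)
    yields the same relation, but through the addition theorem. Its correction term is forced: near
    0 the product has principal part p(a)^2 t^-2, and the sum of the three values has principal part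
    t^-2. The sign of p(a) selects the root. The cubic has only one real root, and it is positive;
    this is the value at 2K/3, where p' is real and the relation gives p >= 0 instead. Two
    conventions shape the analysis. Lattice sums are limits over squares, and the sum of (z - w)^-2
    without its correction does not converge absolutely; periodicity of p is therefore no mere
    reindexing, and the edges of the squares have to be estimated. And since the inverse of 0 is 0,
    p has a finite, meaningless value at its poles: functions built from p are overwritten on the
    lattice before Liouville's theorem applies, and d would take the value 1, not infinity, at a
    further zero of p + 1/3 near a. *)

Local Notation nc := Normc.normc.
Local Notation Re := (@complex.Re _).
Local Notation Im := (@complex.Im _).

(** * Moduli and square partial sums over the lattice *)

Section Modulus.
Variable R : realType.
Implicit Types (x y : R) (z w : R[i]).

Lemma nc_ge0 z : 0 <= nc z. Proof. by case: z => a b; exact: sqrtr_ge0. Qed.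

Lemma nc_eq0 z : (nc z == 0) = (z == 0).
Proof.
by apply/eqP/eqP => [/Normc.eq0_normc //|->]; exact: Normc.normc0.
Qed.

Lemma nc_gt0 z : (0 < nc z) = (z != 0).
Proof. by rewrite lt_def nc_eq0 nc_ge0 andbT. Qed.

Lemma ncB z w : nc (z - w) <= nc z + nc w.
Proof. by rewrite (le_trans (le_normcD _ _))// normcN. Qed.

Lemma nc_distC z w : nc (z - w) = nc (w - z).
Proof. by rewrite -normcN opprB. Qed.

Lemma ncX z n : nc (z ^+ n) = nc z ^+ n.
Proof.
elim: n => [|n IH]; first by rewrite !expr0 Normc.normc1.
by rewrite !exprS Normc.normcM IH.
Qed.

Lemma nc_real x : nc x%:C = `|x|.
Proof. by rewrite /= expr0n addr0 sqrtr_sqr. Qed.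

Lemma nc_sum I (r : seq I) (P : pred I) (F : I -> R[i]) :
  nc (\sum_(i <- r | P i) F i) <= \sum_(i <- r | P i) nc (F i).
Proof.
elim/big_rec2: _ => [|i y z _ h]; first by rewrite Normc.normc0.
by rewrite (le_trans (le_normcD _ _))// lerD2l.
Qed.

Lemma Re_le_nc z : `|Re z| <= nc z.
Proof.
case: z => a b /=; rewrite -sqrtr_sqr ler_sqrt ?addr_ge0 ?sqr_ge0//.
by rewrite lerDl sqr_ge0.
Qed.

Lemma Im_le_nc z : `|Im z| <= nc z.
Proof.
case: z => a b /=; rewrite -sqrtr_sqr ler_sqrt ?addr_ge0 ?sqr_ge0//.
by rewrite lerDr sqr_ge0.
Qed.

Lemma nc_le z : nc z <= `|Re z| + `|Im z|.
Proof.
rewrite [z in nc z]complexE (le_trans (le_normcD _ _))//.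
by rewrite Normc.normcM !nc_real /= expr0n expr1n add0r sqrtr1 mul1r.
Qed.

Lemma nc_gtB z w : nc z - nc w <= nc (z + w).
Proof. by rewrite lerBlDr -{1}[z](addrK w); exact: ncB. Qed.

End Modulus.

Section BoxSums.
Variable R : realType.
Local Notation C := R[i].
Implicit Types (f g : int -> int -> C) (h : int -> C).

Definition seg_sum (N : nat) h : C := \sum_(i < N.*2.+1) h (i%:Z - N%:Z).
Definition box_sum (N : nat) f : C := seg_sum N (fun i => seg_sum N (f i)).

Lemma seg_sumS N h : seg_sum N.+1 h = seg_sum N h + (h (- N.+1%:Z) + h N.+1%:Z).
Proof.
rewrite /seg_sum doubleS big_ord_recr big_ord_recl /=.
have -> : \sum_(i < N.*2.+1) h ((bump 0 i)%:Z - N.+1%:Z) =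
          \sum_(i < N.*2.+1) h (i%:Z - N%:Z).
  by apply: eq_bigr => i _; congr h; rewrite /bump /=; lia.
have -> : N.*2.+2%:Z - N.+1%:Z = N.+1%:Z :> int by lia.
by rewrite sub0r addrAC addrA; ring.
Qed.

Lemma seg_sumD N h1 h2 : seg_sum N (fun i => h1 i + h2 i) = seg_sum N h1 + seg_sum N h2.
Proof. exact: big_split. Qed.

Lemma seg_sumN N h : seg_sum N (fun i => h (- i)) = seg_sum N h.
Proof.
elim: N => [|N IH]; last by rewrite !seg_sumS IH opprK [h _ + _]addrC.
by rewrite /seg_sum !big_ord1 subrr oppr0.
Qed.

Lemma seg_sum_shift N h :
  seg_sum N (fun i => h (i + 1)) = seg_sum N h + (h N.+1%:Z - h (- N%:Z)).
Proof.
elim: N => [|N IH]; first by rewrite /seg_sum !big_ord1 subrr add0r addrCA oppr0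
  subrr addr0.
rewrite !seg_sumS IH.
have -> : - (N.+1)%:Z + 1 = - N%:Z :> int by lia.
have -> : N.+1%:Z + 1 = N.+2%:Z :> int by lia.
ring.
Qed.

Lemma nc_seg_sum N h (b : R) : (forall i : int, (`|i| <= N)%N -> nc (h i) <= b) ->
  nc (seg_sum N h) <= N.*2.+1%:R * b.
Proof.
move=> hb; rewrite (le_trans (nc_sum _ _ _))//.
rewrite (le_trans (ler_sum _ (fun (i : 'I__) _ => hb (i%:Z - N%:Z) _)))//.
  by move=> i; have := ltn_ord i; lia.
by rewrite sumr_const card_ord mulr_natl.
Qed.

Lemma eq_seg_sum N h1 h2 : h1 =1 h2 -> seg_sum N h1 = seg_sum N h2.
Proof. by move=> e; apply: eq_bigr => i _. Qed.

Lemma eq_box_sum N f g : (forall i j, f i j = g i j) -> box_sum N f = box_sum N g.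
Proof. by move=> e; apply: eq_seg_sum => i; apply: eq_seg_sum => j. Qed.

Lemma box_sumD N f g :
  box_sum N (fun i j => f i j + g i j) = box_sum N f + box_sum N g.
Proof. by rewrite /box_sum -seg_sumD; apply: eq_seg_sum => i; rewrite -seg_sumD. Qed.

Lemma box_sumZ N (c : C) f : box_sum N (fun i j => c * f i j) = c * box_sum N f.
Proof.
rewrite /box_sum /seg_sum mulr_sumr; apply: eq_bigr => i _.
by rewrite mulr_sumr.
Qed.

Lemma box_sum_conj N f : box_sum N (fun i j => conjc (f i j)) = conjc (box_sum N f).
Proof.
rewrite /box_sum /seg_sum raddf_sum; apply: eq_bigr => i _.
by rewrite raddf_sum.
Qed.

Lemma box_sumN1 N f : box_sum N (fun i j => f (- i) j) = box_sum N f.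
Proof. exact: (seg_sumN N (fun i => seg_sum N (f i))). Qed.

Lemma box_sumN2 N f : box_sum N (fun i j => f i (- j)) = box_sum N f.
Proof. by apply: eq_seg_sum => i; exact: seg_sumN. Qed.

Lemma box_sumT N f : box_sum N (fun i j => f j i) = box_sum N f.
Proof. by rewrite /box_sum /seg_sum exchange_big. Qed.

Lemma box_sum_shift1 N f : box_sum N (fun i j => f (i + 1) j) =
  box_sum N f + (seg_sum N (f N.+1%:Z) - seg_sum N (f (- N%:Z))).
Proof. exact: (seg_sum_shift N (fun i => seg_sum N (f i))). Qed.

Lemma box_sumS N f : box_sum N.+1 f = box_sum N f +
  (seg_sum N (fun i => f i (- N.+1%:Z) + f i N.+1%:Z)
   + (seg_sum N.+1 (f (- N.+1%:Z)) + seg_sum N.+1 (f N.+1%:Z))).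
Proof.
rewrite /box_sum seg_sumS [RHS]addrA; congr (_ + _).
by rewrite -seg_sumD; apply: eq_seg_sum => i; rewrite seg_sumS.
Qed.

(** Comparable to the modulus of the lattice point of index [(i, j)]; the successor keeps it at
    least 1, so that the origin needs no separate treatment. *)
Definition box_wt (i j : int) : R := (`|i| + `|j|).+1%:R.

Lemma box_wt_gt0 i j : 0 < box_wt i j. Proof. by rewrite ltr0n. Qed.
Lemma box_wt_ge1 i j : 1 <= box_wt i j. Proof. by rewrite ler1n. Qed.

Definition box_cvg f (L : C) :=
  forall e : R, 0 < e -> exists N0, forall N, (N0 <= N)%N -> nc (box_sum N f - L) <= e.

(** The frame between two consecutive squares has [8 * N.+1] points, all of weight at least [N.+2].
    The bound is written as a difference in order to telescope. *)
Lemma box_sum_step N f (c : R) : 0 <= c ->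
  (forall i j, nc (f i j) <= c / box_wt i j ^+ 3) ->
  nc (box_sum N.+1 f - box_sum N f) <= 8 * c * (N.+1%:R^-1 - N.+2%:R^-1).
Proof.
move=> c0 hf; pose b := c / N.+2%:R ^+ 3.
have hb i j : (N < `|i| + `|j|)%N -> nc (f i j) <= b.
  move=> h; rewrite (le_trans (hf i j))// ler_wpM2l// lef_pV2 ?posrE ?exprn_gt0//.
  by rewrite lerXn2r ?nnegrE// ler_nat.
rewrite box_sumS addrAC subrr add0r.
have h1 : nc (seg_sum N (fun i => f i (- N.+1%:Z) + f i N.+1%:Z)) <=
    N.*2.+1%:R * (b + b).
  apply: nc_seg_sum => i _; rewrite (le_trans (le_normcD _ _))// lerD ?hb//; lia.
have h2 : nc (seg_sum N.+1 (f (- N.+1%:Z))) <= N.+1.*2.+1%:R * b.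
  by apply: nc_seg_sum => i _; apply: hb; lia.
have h3 : nc (seg_sum N.+1 (f (N.+1%:Z))) <= N.+1.*2.+1%:R * b.
  by apply: nc_seg_sum => i _; apply: hb; lia.
rewrite (le_trans (le_normcD _ _))//.
rewrite (le_trans (lerD h1 (le_trans (le_normcD _ _) (lerD h2 h3))))//.
have -> : N.*2.+1%:R * (b + b) + (N.+1.*2.+1%:R * b + N.+1.*2.+1%:R * b)
  = 8 * c * (N.+1%:R / N.+2%:R ^+ 3).
  by rewrite /b; have : N.+2%:R != 0 :> R by []; move=> ?; rewrite -!muln2; field.
rewrite ler_wpM2l ?mulr_ge0//.
have p : 0 < N.+1%:R :> R by [].
have -> : N.+2%:R = N.+1%:R + 1 :> R by rewrite -natr1.
move: (N.+1%:R) p => x p.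
have -> : x^-1 - (x + 1)^-1 = (x + 1) ^+ 2 / x / (x + 1) ^+ 3.
  by field; rewrite !lt0r_neq0//; lra.
rewrite ler_wpM2r ?invr_ge0 ?exprn_ge0//; first lra.
by rewrite ler_pdivlMr//; nra.
Qed.

Lemma box_sum_dist N M f (c : R) : 0 <= c ->
  (forall i j, nc (f i j) <= c / box_wt i j ^+ 3) -> (N <= M)%N ->
  nc (box_sum M f - box_sum N f) <= 8 * c / N.+1%:R.
Proof.
move=> c0 hf /subnK <-; move: (M - N)%N => k {M}.
suff : nc (box_sum (k + N) f - box_sum N f) <= 8 * c * (N.+1%:R^-1 - (k + N).+1%:R^-1).
  move/le_trans; apply; rewrite ler_wpM2l ?mulr_ge0//.
  by rewrite gerBl invr_ge0.
elim: k => [|k IH]; first by rewrite add0n !subrr Normc.normc0 mulr0.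
have := lerD (box_sum_step (k + N) c0 hf) IH.
have := le_normcD (box_sum (k + N).+1 f - box_sum (k + N) f) (box_sum (k
  + N) f - box_sum N f).
rewrite addrA subrK -addSn -mulrDr => /le_trans h /h /le_trans; apply.
by rewrite le_eqVlt; apply/orP; left; apply/eqP; congr (_ * _); ring.
Qed.

(* The limit is [sup_n (u n - K / (n + 1))]: each [u m + K / (m + 1)] is an upper bound. *)
Lemma seq_limit (u : nat -> R) (K : R) : 0 <= K ->
  (forall m n, (n <= m)%N -> `|u m - u n| <= K / n.+1%:R) ->
  exists l, forall n, `|u n - l| <= K / n.+1%:R.
Proof.
move=> K0 hu; pose E := [set u n - K / n.+1%:R | n in [set: nat]].
have ubE m : ubound E (u m + K / m.+1%:R).
  move=> _ [n _ <-].
  have kn : 0 <= K / n.+1%:R by rewrite divr_ge0.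
  have km : 0 <= K / m.+1%:R by rewrite divr_ge0.
  have : `|u m - u n| <= K / n.+1%:R \/ `|u n - u m| <= K / m.+1%:R.
    by have [h|/ltnW h] := leqP n m; [left|right]; exact: hu.
  by move: (K / _) (K / _) kn km => a b ? ?; rewrite !ler_norml => -[] /andP[]; lra.
have hE : has_sup E.
  by split; [exists (u 0%N - K / 1%:R); exists 0%N|exists (u 0%N + K / 1%:R);
    exact: ubE].
exists (sup E) => n; rewrite ler_distl; apply/andP; split.
  by rewrite lerBlDr; apply: ge_sup (ubE n); case: hE.
by rewrite -lerBlDr; apply: ub_le_sup; [case: hE|exists n].
Qed.

(** What matters in the bound on the limit is that it is linear in [c]: it turns a termwise
    remainder of order [n] in [t] into a remainder of the whole lattice sum. The proof gives
    [16 * c + c]. *)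
Lemma box_cvg_exists f (c : R) : 0 <= c ->
  (forall i j, nc (f i j) <= c / box_wt i j ^+ 3) ->
  exists L, box_cvg f L /\ nc L <= 33 * c.
Proof.
move=> c0 hf; have c80 : 0 <= 8 * c by rewrite mulr_ge0.
have h m n : (n <= m)%N -> nc (box_sum m f - box_sum n f) <= 8 * c / n.+1%:R.
  exact: box_sum_dist.
have [|l1 h1] := @seq_limit (fun n => Re (box_sum n f)) _ c80.
  move=> m n nm; rewrite (le_trans _ (h m n nm))//.
  by rewrite (le_trans _ (Re_le_nc _))// raddfB.
have [|l2 h2] := @seq_limit (fun n => Im (box_sum n f)) _ c80.
  move=> m n nm; rewrite (le_trans _ (h m n nm))//.
  by rewrite (le_trans _ (Im_le_nc _))// raddfB.
have hL n : nc (box_sum n f - (l1 +i* l2)) <= 16 * c / n.+1%:R.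
  rewrite (le_trans (nc_le _))// !raddfB /=.
  rewrite (le_trans (lerD (h1 n) (h2 n)))// -mulrDl -mulrDl.
  by rewrite le_eqVlt; apply/orP; left; apply/eqP; congr (_ * _ / _); ring.
exists (l1 +i* l2); split.
  move=> e e0; exists (Num.truncn (16 * c / e)) => N hN.
  rewrite (le_trans (hL N))// ler_pdivrMr// -ler_pdivrMl// mulrC.
  rewrite (le_trans (ltW (truncnS_gt _)))// ler_nat//.
have := hL 0%N; rewrite divr1 => h0.
have -> : l1 +i* l2 = box_sum 0 f - (box_sum 0 f - (l1 +i* l2)) by ring.
rewrite (le_trans (ncB _ _))//.
have : nc (box_sum 0 f) <= c.
  rewrite /box_sum /seg_sum !big_ord1; apply: (le_trans (hf _ _)).
  by rewrite subrr /box_wt /= expr1n divr1.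
move: h0; lra.
Qed.

Lemma box_cvgD f g L M : box_cvg f L -> box_cvg g M -> box_cvg (fun i j =>
  f i j + g i j) (L + M).
Proof.
move=> hf hg e e0; have e2 : 0 < e / 2 by rewrite divr_gt0.
have [N1 h1] := hf _ e2; have [N2 h2] := hg _ e2.
exists (maxn N1 N2) => N; rewrite geq_max => /andP[n1 n2].
rewrite box_sumD.
have -> : box_sum N f + box_sum N g - (L + M) = (box_sum N f - L)
  + (box_sum N g - M) by ring.
rewrite (le_trans (le_normcD _ _))//.
have := lerD (h1 N n1) (h2 N n2); lra.
Qed.

Lemma box_cvgZ f L (c : C) : box_cvg f L -> box_cvg (fun i j => c * f i j) (c * L).
Proof.
move=> hf e e0; have c1 : 0 < nc c + 1 by rewrite ltr_wpDl// nc_ge0.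
have [N1 h1] := hf _ (divr_gt0 e0 c1).
exists N1 => N /h1 h; rewrite box_sumZ -mulrBr Normc.normcM.
rewrite (le_trans (ler_wpM2l (nc_ge0 _) h))// mulrCA ler_piMr ?(ltW e0)//.
by rewrite ler_pdivrMr//; lra.
Qed.

Lemma box_cvg_unique f L M : box_cvg f L -> box_cvg f M -> L = M.
Proof.
move=> hL hM; apply/eqP; rewrite -subr_eq0 -nc_eq0; apply/negP => /negP n0.
have p : 0 < nc (L - M) by rewrite lt_def n0 nc_ge0.
have p4 : 0 < nc (L - M) / 4 by lra.
have [N1 h1] := hL _ p4; have [N2 h2] := hM _ p4.
have := h1 (maxn N1 N2) (leq_maxl _ _); have := h2 (maxn N1 N2) (leq_maxr _ _).
set b := box_sum _ _ => u v.
have := ncB (b - M) (b - L).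
have -> : b - M - (b - L) = L - M by ring.
by move=> w; have := le_trans w (lerD u v); lra.
Qed.

Lemma eq_box_cvg f g L : (forall N,
  box_sum N f = box_sum N g) -> box_cvg f L -> box_cvg g L.
Proof. by move=> e h x /h[N0 k]; exists N0 => N /k; rewrite e. Qed.

Lemma box_cvg_conj f L : box_cvg f L -> box_cvg (fun i j => conjc (f i j)) (conjc L).
Proof.
move=> h e /h[N0 k]; exists N0 => N /k; rewrite box_sum_conj -rmorphB.
by case: (_ - L) => a b /=; rewrite sqrrN.
Qed.

(** The shifted sum differs from the original by two edge columns, each with [N.*2.+1] terms of
    order [N ^- 2]. The exponent 2, too weak for absolute convergence, is the one met by the
    Weierstrass function. *)
Lemma box_cvg_shift1 f (c : R) : 0 <= c ->
  (forall i j, nc (f i j) <= c / box_wt i j ^+ 2) ->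
  box_cvg (fun i j => f (i + 1) j - f i j) 0.
Proof.
move=> c0 hf e e0; exists (Num.truncn (4 * c / e)) => N hN.
have bd (i : int) : (N <= `|i|)%N -> nc (seg_sum N (f i)) <= 2 * c / N.+1%:R.
  move=> hi; apply: (@le_trans _ _ (N.*2.+1%:R * (c / N.+1%:R ^+ 2))).
    apply: nc_seg_sum => j _; rewrite (le_trans (hf i j))// ler_wpM2l//.
    rewrite lef_pV2 ?posrE ?exprn_gt0// lerXn2r ?nnegrE// ler_nat; lia.
  have -> : 2 * c / N.+1%:R = (2 * N.+1%:R) * (c / N.+1%:R ^+ 2).
    by have : N.+1%:R != 0 :> R by []; move=> ?; field.
  rewrite ler_wpM2r ?divr_ge0 ?exprn_ge0// -natrM ler_nat; lia.
rewrite box_sumD (@eq_box_sum N (fun i j => - f i j) (fun i j => -1 * f i j)) =>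
  [|i j]; last by rewrite mulN1r.
rewrite box_sumZ box_sum_shift1 mulN1r subr0 addrAC subrr add0r.
have hu : nc (seg_sum N (f N.+1%:Z)) <= 2 * c / N.+1%:R by apply: bd; lia.
have hv : nc (seg_sum N (f (- N%:Z))) <= 2 * c / N.+1%:R by apply: bd; lia.
rewrite (le_trans (ncB _ _))// (le_trans (lerD hu hv))//.
have -> : 2 * c / N.+1%:R + 2 * c / N.+1%:R = 4 * c / N.+1%:R by ring.
rewrite ler_pdivrMr// -ler_pdivrMl// mulrC.
by rewrite (le_trans (ltW (truncnS_gt _)))// ler_nat.
Qed.

Lemma box_cvgT f L : box_cvg f L -> box_cvg (fun i j => f j i) L.
Proof. by apply: eq_box_cvg => N; rewrite box_sumT. Qed.

Lemma box_wt_sym i j : box_wt i j = box_wt j i.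
Proof. by rewrite /box_wt addnC. Qed.

Lemma box_cvg_shift2 f (c : R) : 0 <= c ->
  (forall i j, nc (f i j) <= c / box_wt i j ^+ 2) ->
  box_cvg (fun i j => f i (j + 1) - f i j) 0.
Proof.
move=> c0 hf; apply: (@box_cvgT (fun i j => f j (i + 1) - f j i)).
by apply: (@box_cvg_shift1 (fun i j => f j i) c c0) => i j; rewrite box_wt_sym.
Qed.

Lemma box_sum_delta N (a : C) :
  box_sum N (fun i j => if (i == 0) && (j == 0) then a else 0) = a.
Proof.
elim: N => [|N IH]; first by rewrite /box_sum /seg_sum !big_ord1 subrr eqxx.
rewrite box_sumS IH.
have z1 (h : int -> C) M : h =1 (fun=> 0) -> seg_sum M h = 0.
  by move=> h0; rewrite /seg_sum big1 // => i _; rewrite h0.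
rewrite !z1 ?addr0// => i; rewrite ?andbF ?addr0//.
Qed.

Lemma box_cvg_cst f (a : C) : (forall N, box_sum N f = a) -> box_cvg f a.
Proof.
by move=> h e e0; exists 0%N => N _; rewrite h subrr Normc.normc0 ltW.
Qed.

Lemma box_cvg_sum n (F : nat -> int -> int -> C) (L : nat -> C) :
  (forall m, (m < n)%N -> box_cvg (F m) (L m)) ->
  box_cvg (fun i j => \sum_(m < n) F m i j) (\sum_(m < n) L m).
Proof.
elim: n => [|n IH] h.
  rewrite big_ord0; apply: box_cvg_cst => N.
  by rewrite /box_sum /seg_sum big1// => i _; rewrite big1// => j _; rewrite big_ord0.
rewrite big_ord_recr /=.
apply: (eq_box_cvg _ (box_cvgD (IH _) (h n _))) => // [N|m mn]; last exact/h/ltnW.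
by apply: eq_box_sum => i j; rewrite big_ord_recr.
Qed.

Definition box_lim f : C := xget 0 [set L | box_cvg f L].

Lemma box_limE f L : box_cvg f L -> box_lim f = L.
Proof. by move=> h; exact: (box_cvg_unique (xgetPex 0 (ex_intro _ L h))). Qed.

End BoxSums.

(** * Local expansions and Liouville's theorem *)

Section Jets.
Variable R : realType.
Local Notation C := R[i].
Implicit Types (f g : C -> C) (t z w : C) (n m : nat).

(* [f t = O(t^n)] as [t -> 0], [t != 0]; nothing is said about [f 0]. *)
Definition isO n f := exists c d : R, [/\ 0 <= c, 0 < d &
  forall t, t != 0 -> nc t < d -> nc (f t) <= c * nc t ^+ n].

Lemma isO_near n f g (d : R) : 0 < d ->
  (forall t, t != 0 -> nc t < d -> f t = g t) -> isO n f -> isO n g.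
Proof.
move=> d0 e [c [d' [c0 d'0 h]]]; exists c, (Num.min d d').
split=> // [|t t0]; first by rewrite lt_min d0.
by rewrite lt_min => /andP[td td']; rewrite -e// h.
Qed.

Lemma isO_ext n f g : (forall t, t != 0 -> f t = g t) -> isO n f -> isO n g.
Proof. by move=> e; apply: (@isO_near _ _ _ 1) => // t t0 _; exact: e. Qed.

Lemma isOD n f g : isO n f -> isO n g -> isO n (fun t => f t + g t).
Proof.
move=> [c [d [c0 d0 h]]] [c' [d' [c'0 d'0 h']]].
exists (c + c'), (Num.min d d'); split; first by rewrite addr_ge0.
  by rewrite lt_min d0.
move=> t t0; rewrite lt_min => /andP[td td'].
by rewrite (le_trans (le_normcD _ _))// mulrDl lerD ?h ?h'.
Qed.

Lemma isOM n m f g : isO n f -> isO m g -> isO (n + m) (fun t => f t * g t).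
Proof.
move=> [c [d [c0 d0 h]]] [c' [d' [c'0 d'0 h']]].
exists (c * c'), (Num.min d d'); split; first by rewrite mulr_ge0.
  by rewrite lt_min d0.
move=> t t0; rewrite lt_min => /andP[td td'].
rewrite Normc.normcM exprD mulrACA ler_pM ?nc_ge0 ?h ?h'//.
Qed.

Lemma isO_cst c : isO 0 (fun=> c).
Proof.
by exists (nc c), 1; split=> [||t _ _]; rewrite ?nc_ge0// expr0 mulr1.
Qed.

Lemma isO_id : isO 1 id.
Proof. by exists 1, 1; split=> // t _ _; rewrite expr1 mul1r. Qed.

Lemma isOW n m f : (m <= n)%N -> isO n f -> isO m f.
Proof.
move=> mn [c [d [c0 d0 h]]]; exists c, (Num.min d 1); split=> //.
  by rewrite lt_min d0/=.
move=> t t0; rewrite lt_min => /andP[td t1]; rewrite (le_trans (h t t0 td))//.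
by rewrite ler_wpM2l// ler_wiXn2l ?nc_ge0 ?(ltW t1).
Qed.

Lemma isOX n : isO n (fun t => t ^+ n).
Proof.
by exists 1, 1; split=> // t _ _; rewrite ncX mul1r.
Qed.

Lemma isOMX n f : isO 0 f -> isO n (fun t => t ^+ n * f t).
Proof. by move=> h; have := isOM (isOX n) h; rewrite addn0. Qed.

Lemma isO_div n m f : isO (n + m) f -> isO n (fun t => f t / t ^+ m).
Proof.
move=> [c [d [c0 d0 h]]]; exists c, d; split=> // t t0 td.
rewrite Normc.normcM Normc.normcV ncX ler_pdivrMr ?exprn_gt0 ?nc_gt0//.
by rewrite -mulrA -exprD h.
Qed.

Lemma isON n f : isO n f -> isO n (fun t => - f t).
Proof. by move=> [c [d [c0 d0 h]]]; exists c, d; split=> // t *; rewrite normcN h. Qed.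

Lemma isOM0 f g : isO 0 f -> isO 0 g -> isO 0 (fun t => f t * g t).
Proof. exact: isOM. Qed.

Lemma isO_exp0 n f : isO 0 f -> isO 0 (fun t => f t ^+ n).
Proof.
move=> h; elim: n => [|n IH]; first exact: isO_cst.
by apply: (isO_ext _ (isOM0 h IH)) => t _; rewrite exprS.
Qed.

Lemma isO_poly (p : {poly C}) : isO 0 (horner p).
Proof.
elim/poly_ind: p => [|p c IH].
  by apply: (isO_ext _ (isO_cst 0)) => t _; rewrite horner0.
apply: (isO_ext _ (isOD (isOM0 IH (isOW (leq0n 1) isO_id)) (isO_cst c))) => t _.
by rewrite hornerMXaddC.
Qed.

Lemma isO_sub f : isO 1 f -> forall e : R, 0 < e -> exists2 d : R, 0 < d &
  forall t, t != 0 -> nc t < d -> nc (f t) <= e.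
Proof.
move=> [c [d [c0 d0 h]]] e e0; exists (Num.min d (e / (c + 1))).
  by rewrite lt_min d0 divr_gt0//; lra.
move=> t t0; rewrite lt_min ltr_pdivlMr; last by lra.
move=> /andP[td te]; rewrite (le_trans (h t t0 td))// expr1.
by have := nc_ge0 t; nra.
Qed.

(* [f] agrees with a polynomial up to [O(t^n)] near [0], and exactly at [0]; for
   [n = 3] this is the second-order Taylor expansion that replaces holomorphy below. *)
Definition has_jet n f := exists p : {poly C}, f 0 = p.[0] /\ isO n (fun t =>
  f t - p.[t]).

Lemma jet_near n f g (d : R) : 0 < d -> (forall t, nc t < d -> f t = g t) ->
  has_jet n f -> has_jet n g.
Proof.
move=> d0 e [p [p0 h]]; exists p; split; first by rewrite -e ?Normc.normc0.
by apply: (isO_near d0 _ h) => t _ td; rewrite e.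
Qed.

Lemma jet_ext n f g : f =1 g -> has_jet n f -> has_jet n g.
Proof. by move=> e; apply: (@jet_near _ _ _ 1). Qed.

Lemma jet_poly n (p : {poly C}) : has_jet n (horner p).
Proof.
exists p; split=> //; apply: (isO_ext _ (isOMX n (isO_cst 0))) => t _.
by rewrite mulr0 subrr.
Qed.

Lemma jet_cst n c : has_jet n (fun=> c).
Proof. by apply: (jet_ext _ (jet_poly n c%:P)) => t; rewrite hornerC. Qed.

Lemma jetD n f g : has_jet n f -> has_jet n g -> has_jet n (fun t => f t + g t).
Proof.
move=> [p [p0 hp]] [q [q0 hq]]; exists (p + q); split.
  by rewrite hornerD p0 q0.
by apply: (isO_ext _ (isOD hp hq)) => t _; rewrite hornerD; ring.
Qed.

Lemma jet_bO n f : has_jet n f -> isO 0 f.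
Proof.
move=> [p [p0 h]]; apply: (isO_ext _ (isOD (isOW (leq0n n) h) (isO_poly p))) => t _.
by rewrite subrK.
Qed.

Lemma jetM n f g : has_jet n f -> has_jet n g -> has_jet n (fun t => f t * g t).
Proof.
move=> jf jg; have [p [p0 hp]] := jf; have [q [q0 hq]] := jg.
exists (p * q); split; first by rewrite hornerM p0 q0.
have h1 := isOM hp (jet_bO jg); rewrite addn0 in h1.
by apply: (isO_ext _ (isOD h1 (isOM (isO_poly p) hq))) => t _; rewrite hornerM; ring.
Qed.

Lemma jetX n m f : has_jet n f -> has_jet n (fun t => f t ^+ m).
Proof.
move=> h; elim: m => [|m IH]; first exact: jet_cst.
by apply: (jet_ext _ (jetM h IH)) => t; rewrite exprS.
Qed.

Lemma jetN n f : has_jet n f -> has_jet n (fun t => - f t).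
Proof.
by move=> h; apply: (jet_ext _ (jetM (jet_cst n (-1)) h)) => t; rewrite mulN1r.
Qed.

Lemma jetB n f g : has_jet n f -> has_jet n g -> has_jet n (fun t => f t - g t).
Proof. by move=> hf /jetN; exact: jetD. Qed.

Lemma jetW n m f : (m <= n)%N -> has_jet n f -> has_jet m f.
Proof. by move=> mn [p [p0 h]]; exists p; split=> //; exact: isOW h. Qed.

Lemma jet_quad f : has_jet 3 f -> exists b c, isO 3 (fun t =>
  f t - (f 0 + b * t + c * t ^+ 2)).
Proof.
move=> [p [p0 h]].
have fac (q : {poly C}) : exists q', q = q' * 'X + q.[0]%:P.
  have : root (q - q.[0]%:P) 0 by rewrite rootE !hornerE subrr.
  by move=> /factor_theorem[q']; rewrite subr0 => e; exists q'; rewrite -e subrK.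
have [p1 e1] := fac p; have [p2 e2] := fac p1; have [p3 e3] := fac p2.
exists p1.[0], p2.[0]; apply: (isO_ext _ (isOD h (isOMX 3 (isO_poly p3)))) => t _.
rewrite p0 {1}e1 {1}e2 {1}e3 !(hornerD, hornerM, hornerX, hornerC); ring.
Qed.

Lemma jet_cont f : has_jet 1 f -> forall e : R, 0 < e -> exists2 d : R, 0 < d &
  forall t, nc t < d -> nc (f t - f 0) <= e.
Proof.
move=> [p [p0 h]].
have : root (p - p.[0]%:P) 0 by rewrite rootE !hornerE subrr.
move=> /factor_theorem[q]; rewrite subr0 => e.
have hb : isO 1 (fun t => f t - f 0).
  have := isOD h (isOM (isO_poly q) isO_id); apply: isO_ext => t _.
  have -> : p = q * 'X + p.[0]%:P by rewrite -e subrK.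
  by rewrite p0 !(hornerD, hornerM, hornerX, hornerC); ring.
move=> x x0; have [d d0 hd] := isO_sub hb x0.
exists d => // t td; have [->|t0] := eqVneq t 0; last exact: hd.
by rewrite subrr Normc.normc0 ltW.
Qed.

Lemma jet_inv w : w != 0 -> has_jet 4 (fun t => (w + t)^-1).
Proof.
move=> w0; pose p := (w^-1)%:P - (w ^- 2)%:P * 'X
  + (w ^- 3)%:P * 'X^2 - (w ^- 4)%:P * 'X^3 : {poly C}.
have bi : isO 0 (fun t => (w + t)^-1).
  have nw : 0 < nc w by rewrite nc_gt0.
  exists (2 / nc w), (nc w / 2).
  split; [by rewrite divr_ge0// ltW|by rewrite divr_gt0|].
  move=> t _ tw; rewrite Normc.normcV expr0 mulr1.
  rewrite -[2]invrK -invfM lef_pV2 ?posrE ?mulr_gt0 ?invr_gt0//.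
    by have := nc_gtB w t; lra.
  by have := nc_gtB w t; lra.
exists p; split.
  by rewrite addr0 !(hornerD, hornerN, hornerM, hornerX, hornerXn, hornerC); ring.
(* This is the exact remainder of the truncated geometric series. *)
apply: (@isO_near _ (fun t => t ^+ 4 * (w ^- 4 * (w + t)^-1)) _ (nc w));
  rewrite ?nc_gt0//.
  move=> t t0 tw; rewrite !(hornerD, hornerN, hornerM, hornerX, hornerXn, hornerC).
  have : w + t != 0.
    by rewrite -nc_eq0; have := nc_gtB w t; apply: contraTneq => ->; lra.
  by move=> ?; field; apply/andP.
by apply: isOMX; apply: isOM0 => //; exact: isO_cst.
Qed.

End Jets.

(** * Maximum principle and Liouville's theorem *)

Section Liouville.
Variable R : realType.
Local Notation C := R[i].
Implicit Types (F g : C -> C) (z t : C).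

Lemma ReD z t : Re (z + t) = Re z + Re t. Proof. by case: z; case: t. Qed.
Lemma ImD z t : Im (z + t) = Im z + Im t. Proof. by case: z; case: t. Qed.
Lemma ReN z : Re (- z) = - Re z. Proof. by case: z. Qed.
Lemma ImN z : Im (- z) = - Im z. Proof. by case: z. Qed.

Lemma Re_mulz z (n : int) : Re (z *~ n) = Re z *~ n.
Proof.
have Rn m : Re (z *+ m) = Re z *+ m.
  by elim: m => [|m IH]; rewrite ?mulr0n// !mulrSr ReD IH.
by case: n => n; rewrite ?NegzE ?mulrNz ?ReN -!pmulrn Rn.
Qed.

Lemma Im_mulz z (n : int) : Im (z *~ n) = Im z *~ n.
Proof.
have Rn m : Im (z *+ m) = Im z *+ m.
  by elim: m => [|m IH]; rewrite ?mulr0n// !mulrSr ImD IH.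
by case: n => n; rewrite ?NegzE ?mulrNz ?ImN -!pmulrn Rn.
Qed.

Lemma rectangle_EVT (phi : C -> R) (a b : R) : 0 <= a -> 0 <= b ->
  (forall z (e : R), 0 < e -> exists2 d : R, 0 < d &
     forall t, nc t < d -> `|phi (z + t) - phi z| <= e) ->
  exists2 z0, (`|Re z0| <= a) && (`|Im z0| <= b) &
    forall z, `|Re z| <= a -> `|Im z| <= b -> phi z <= phi z0.
Proof.
move=> a0 b0 hphi; pose f (p : R * R) := phi (p.1 +i* p.2).
pose A : set (R * R) := `[- a, a]%classic `*` `[- b, b]%classic.
have cf : {within A, continuous f}.
  apply: continuous_subspaceT => p; apply/cvgrPdist_le => e e0.
  have [d d0 hd] := hphi (p.1 +i* p.2) e e0.
  have d2 : 0 < d / 2 by rewrite divr_gt0.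
  exists (ball p.1 (d / 2), ball p.2 (d / 2)); first by split; exact: nbhsx_ballx.
  move=> q [/= q1 q2]; rewrite distrC.
  have e1 : q.1 +i* q.2 = (p.1 +i* p.2) + ((q.1 - p.1) +i* (q.2 - p.2)).
    by apply/eqP; rewrite eq_complex /=; apply/andP; split; apply/eqP; ring.
  rewrite /f e1; apply: hd; rewrite (le_lt_trans (nc_le _))//=.
  rewrite /ball /= in q1 q2.
  rewrite distrC [`|q.2 - _|]distrC; lra.
have cA : compact A by apply: compact_setX; exact: segment_compact.
have A0 : A !=set0.
  by exists (0, 0); split; rewrite /= in_itv /=; apply/andP; split; lra.
have [c cA' hc] := compact_EVT_max A0 cA cf.
exists (c.1 +i* c.2).
  move: cA'; rewrite inE => -[/=]; rewrite !in_itv /= => /andP[? ?] /andP[? ?].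
  by apply/andP; split; rewrite ler_norml; apply/andP.
move=> [x y] /=; rewrite !ler_norml => hx hy.
by apply: (hc (x, y)); rewrite inE; split; rewrite /= in_itv.
Qed.

(* At an interior maximum [z0] of [Re g + e |z|^2], the values of [g] at [z0 +- h] and
   [z0 +- ih] add up to [4 g z0 + O(h^3)], while those of [e |z|^2] gain [4 e h^2]. *)
Lemma max_principle g (m r : R) : 0 < r -> (forall z, has_jet 3 (fun t => g (z + t))) ->
  (forall z, (`|Re z| = r \/ `|Im z| = r) -> `|Re z| <= r -> `|Im z| <= r ->
     Re (g z) <= m) ->
  forall z, `|Re z| <= r -> `|Im z| <= r -> Re (g z) <= m.
Proof.
move=> r0 hg hb z hz1 hz2; apply/ler_addgt0Pl => e' e'0.
(* On the square [nc z ^+ 2 <= 2 * r ^+ 2], so the perturbation [e * nc z ^+ 2] is at most [e']. *)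
pose e := e' / (2 * r ^+ 2).
have e0 : 0 < e by rewrite divr_gt0// mulr_gt0// exprn_gt0.
have er : e * (2 * r ^+ 2) = e' by rewrite mulfVK// mulf_neq0// ?expf_neq0// lt0r_neq0.
clearbody e.
pose phi z := Re (g z) + e * nc z ^+ 2.
have [|z0 /andP[z01 z02] hmax] := @rectangle_EVT phi r r (ltW r0) (ltW r0).
  move=> w x x0; have x2 : 0 < x / 2 by rewrite divr_gt0.
  have [d d0 hd] := jet_cont (jetW (isT : (1 <= 3)%N) (hg w)) x2.
  have nw := nc_ge0 w; pose s := e * (2 * nc w + 1).
  have s0 : 0 <= s by rewrite mulr_ge0 ?(ltW e0)//; lra.
  exists (Num.min d (Num.min 1 (x / 2 / (s + 1)))).
    by rewrite !lt_min d0 ltr01 !divr_gt0//; lra.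
  move=> t; rewrite !lt_min => /andP[td /andP[t1]].
  rewrite ltr_pdivlMr => [ts|]; last lra.
  have h1 := hd t td; rewrite addr0 in h1.
  have h2 : `|Re (g (w + t)) - Re (g w)| <= x / 2.
    by rewrite (le_trans _ h1)// (le_trans _ (Re_le_nc _))// raddfB.
  have h3 : `|e * nc (w + t) ^+ 2 - e * nc w ^+ 2| <= s * nc t.
    rewrite -mulrBr normrM gtr0_norm// /s -mulrA ler_wpM2l ?(ltW e0)//.
    have := le_normcD w t; have := nc_gtB w t; have := nc_ge0 (w + t).
    by have := nc_ge0 t => t0 u0 u1 u2; rewrite ler_norml; apply/andP; split; nra.
  have -> : phi (w + t) - phi w = (Re (g (w + t)) - Re (g w)) +
      (e * nc (w + t) ^+ 2 - e * nc w ^+ 2) by rewrite /phi; ring.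
  rewrite (le_trans (ler_normD _ _))//; have := nc_ge0 t; nra.
have nc2 w : nc w ^+ 2 = Re w ^+ 2 + Im w ^+ 2.
  by case: w => u v; rewrite /= sqr_sqrtr ?addr_ge0 ?sqr_ge0.
have sqr (w : C) : `|Re w| <= r -> `|Im w| <= r -> nc w ^+ 2 <= 2 * r ^+ 2.
  rewrite nc2 !ler_norml => /andP[? ?] /andP[? ?].
  have u1 : 0 <= (r - Re w) * (r + Re w) by apply: mulr_ge0; lra.
  have u2 : 0 <= (r - Im w) * (r + Im w) by apply: mulr_ge0; lra.
  lra.
have hz : Re (g z) <= phi z0.
  rewrite (le_trans _ (hmax z hz1 hz2))// lerDl mulr_ge0 ?(ltW e0)//.
  by rewrite exprn_ge0// nc_ge0.
have [bd|bd] := pselect (`|Re z0| = r \/ `|Im z0| = r).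
  rewrite (le_trans hz)// /phi addrC lerD//; last exact: hb.
  by rewrite -er ler_wpM2l ?(ltW e0)// sqr.
exfalso.
have {}z01 : `|Re z0| < r.
  by rewrite lt_neqAle z01 andbT; apply/eqP => ?; apply: bd; left.
have {}z02 : `|Im z0| < r.
  by rewrite lt_neqAle z02 andbT; apply/eqP => ?; apply: bd; right.
have [b [c [K [d [K0 d0]]]]] := jet_quad (hg z0); rewrite addr0 => hE.
(* The four points stay in the square and within reach of the expansion, and [K * h < e] makes the
   gain [4 * e * h ^+ 2] exceed the total error [4 * K * h ^+ 3]. *)
pose h := Num.min (d / 2) (Num.min ((r - `|Re z0|) / 2)
  (Num.min ((r - `|Im z0|) / 2) (e / 2 / (K + 1)))).
have K1 : 0 < K + 1 by rewrite ltr_wpDl.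
have h0 : 0 < h by rewrite /h !lt_min !divr_gt0 ?subr_gt0.
have [hd h1 h2 h3] : [/\ h < d, h < r - `|Re z0|, h < r - `|Im z0| & K * h < e].
  have : h <= h by [].
  rewrite {2}/h !le_min => /andP[? /andP[? /andP[?]]].
  rewrite ler_pdivlMr => [?|]; last lra.
  by split; [lra|lra|lra|nra].
pose E t := g (z0 + t) - (g z0 + b * t + c * t ^+ 2).
have EB t : nc t = h -> - (K * h ^+ 3) <= Re (E t).
  move=> th; have t0 : t != 0 by rewrite -nc_gt0 th.
  have := hE t t0; rewrite th => /(_ hd) => hh.
  have := le_trans (Re_le_nc _) hh; rewrite ler_norml => /andP[? _]; exact.
have four : g (z0 + h%:C) + g (z0 - h%:C) + g (z0 + h *i) + g (z0 - h *i) =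
    4 * g z0 + (E h%:C + E (- h%:C) + E (h *i) + E (- (h *i))).
  have i2 : (h *i) ^+ 2 = - (h%:C) ^+ 2 :> C.
    by apply/eqP; rewrite eq_complex /=; apply/andP; split; apply/eqP; ring.
  have EE t : E t = g (z0 + t) - (g z0 + b * t + c * t ^+ 2) by [].
  by rewrite !EE !sqrrN i2; ring.
clearbody E h.
have nh : `|h| = h by rewrite gtr0_norm.
have n1 : nc h%:C = h by rewrite nc_real.
have n2 : nc (- h%:C) = h by rewrite normcN.
have n3 : nc (h *i : C) = h by rewrite /= expr0n add0r sqrtr_sqr.
have n4 : nc (- (h *i : C)) = h by rewrite normcN.
have := congr1 Re four; rewrite !ReD.
have -> : Re (4 * g z0) = 4 * Re (g z0) by case: (g z0) => u v /=; simpc.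
have := EB _ n1; have := EB _ n2; have := EB _ n3; have := EB _ n4.
have m1 : phi (z0 + h%:C) <= phi z0.
  by apply: hmax; rewrite ?ReD ?ImD /= ?addr0 ?(ltW z02)// (le_trans (ler_normD _
    _))// nh; lra.
have m2 : phi (z0 - h%:C) <= phi z0.
  by apply: hmax; rewrite ?ReD ?ImD ?ReN ?ImN /= ?subr0 ?(ltW z02)// (le_trans
    (ler_normB _ _))// nh; lra.
have m3 : phi (z0 + h *i) <= phi z0.
  by apply: hmax; rewrite ?ReD ?ImD /= ?addr0 ?(ltW z01)// (le_trans (ler_normD _
    _))// nh; lra.
have m4 : phi (z0 - h *i) <= phi z0.
  by apply: hmax; rewrite ?ReD ?ImD ?ReN ?ImN /= ?subr0 ?(ltW z01)// (le_trans
    (ler_normB _ _))// nh; lra.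
move: m1 m2 m3 m4; rewrite /phi !nc2 !(ReD, ImD, ReN, ImN) /= !addr0 !subr0.
move: (Re (g (z0 + h%:C))) (Re (g (z0 - h%:C))) (Re (g (z0
  + h *i))) (Re (g (z0 - h *i))) => g1 g2 g3 g4.
move: (Re (E (h%:C))) (Re (E (- h%:C))) (Re (E (h *i))) (Re (E (- h *i))) =>
  E1 E2 E3 E4.
move: (Re (g z0)) (Re z0) (Im z0) => G x y m1 m2 m3 m4 k1 k2 k3 k4 k5.
have k6 : 4 * e * h ^+ 2 <= 4 * (K * h ^+ 3) by lra.
have : 0 < (e - K * h) * h ^+ 2 by rewrite mulr_gt0 ?exprn_gt0//; lra.
by rewrite mulrBl -mulrA -exprS subr_gt0; lra.
Qed.

(* [(F z - F 0) / z] is bounded by [2 M / r] on the boundary of the square of half-side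
   [r], hence inside; let [r] go to infinity. *)
Lemma liouville_bounded F (M : R) : (forall z, has_jet 4 (fun t => F (z + t))) ->
  (forall z, nc (F z) <= M) -> forall z, F z = F 0.
Proof.
move=> hF hM.
have M0 : 0 <= M by rewrite (le_trans (nc_ge0 (F 0))).
have [p [p0 hp]] := hF 0; rewrite addr0 in p0.
have : root (p - p.[0]%:P) 0 by rewrite rootE !hornerE subrr.
move=> /factor_theorem[q]; rewrite subr0 => eq.
(* The value [q.[0]] removes the singularity at [0]. The division costs one order, which is why jets
   of order 4 are assumed of [F] while [max_principle] asks for order 3. *)
pose g z := if z == 0 then q.[0] else (F z - F 0) / z.
have g3 z : has_jet 3 (fun t => g (z + t)).
  have [->|z0] := eqVneq z 0.
    exists q; split; first by rewrite /g addr0 eqxx.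
    apply: (isO_ext _ (isO_div (hp : isO (3 + 1) _))) => t t0.
    rewrite /g add0r (negPf t0) p0.
    have -> : p.[t] = q.[t] * t + p.[0].
      by rewrite -[in LHS](subrK p.[0]%:P p) eq !hornerE.
    by field.
  have := jetM (jetB (hF z) (jet_cst 4 (F 0))) (jet_inv z0).
  move=> /(jetW (isT : (3 <= 4)%N)); apply: (@jet_near _ _ _ _ (nc z)).
    by rewrite nc_gt0.
  move=> t tz; rewrite /g ifF//; apply/negbTE; rewrite -nc_eq0.
  by have := nc_gtB z t; apply: contraTneq => ->; lra.
(* Only real parts are controlled by [max_principle]; the four units [1], [-1], ['i], [- 'i]
   together force [g z = 0]. *)
have key (u : C) z : nc u = 1 -> Re (u * g z) <= 0.
  move=> u1; apply/ler_addgt0Pl => e e0; rewrite addr0.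
  pose r := Num.max (nc z + 1) (2 * M / e).
  have r1 : nc z + 1 <= r by rewrite le_max lexx.
  have r2 : 2 * M / e <= r by rewrite le_max lexx orbT.
  have r0 : 0 < r by rewrite (lt_le_trans _ r1)// ltr_wpDl// nc_ge0.
  apply: (@max_principle (fun z => u * g z) e r r0).
  - by move=> w; apply: jetM (g3 w); exact: jet_cst.
  - move=> w wr _ _; rewrite (le_trans (ler_norm _))// (le_trans (Re_le_nc _))//.
    rewrite Normc.normcM u1 mul1r.
    have wr' : r <= nc w.
      by case: wr => <-; [exact: Re_le_nc|exact: Im_le_nc].
    have w0 : w != 0 by rewrite -nc_gt0 (lt_le_trans r0).
    rewrite /g (negPf w0) Normc.normcM Normc.normcV ler_pdivrMr ?nc_gt0//.
    rewrite (le_trans (ncB _ _))// (le_trans (lerD (hM _) (hM _)))//.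
    move: r2; rewrite ler_pdivrMr// => r2.
    have : r * e <= e * nc w by rewrite mulrC ler_wpM2l// ltW.
    lra.
  - by rewrite (le_trans (Re_le_nc _))//; lra.
  - by rewrite (le_trans (Im_le_nc _))//; lra.
move=> z; have [->//|z0] := eqVneq z 0.
have : g z = 0.
  have k1 := key 1 z (Normc.normc1 _).
  have k2 := key (-1) z; rewrite normcN Normc.normc1 in k2; have {}k2 := k2 erefl.
  have ni : nc ('i : C) = 1 by rewrite /= expr0n expr1n add0r sqrtr1.
  have k3 := key 'i z ni.
  have k4 := key (- 'i) z; rewrite normcN ni in k4; have {}k4 := k4 erefl.
  move: k1 k2 k3 k4; case: (g z) => a b; rewrite mul1r mulN1r /=.
  rewrite !mul0r oppr0 !mul0r !mul1r !mulN1r !sub0r opprK => k1 k2 k3 k4.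
  by apply/eqP; rewrite eq_complex /=; apply/andP; split; rewrite eq_le;
    apply/andP; split; lra.
rewrite /g (negPf z0) => /eqP; rewrite mulf_eq0 invr_eq0 (negPf z0) orbF.
by rewrite subr_eq0 => /eqP.
Qed.

Lemma periodicZ (f : C -> C) w : (forall z, f (z + w) = f z) ->
  forall (n : int) z, f (z + w *~ n) = f z.
Proof.
move=> h; have perN (n : nat) z : f (z + w *+ n) = f z.
  by elim: n => [|n IH]; rewrite ?mulr0n ?addr0// mulrSr addrA h.
case=> n z; first exact: perN.
by rewrite NegzE -[in RHS](subrK (w *+ n.+1) z) perN// mulrNz.
Qed.

(** Periods move every point into a compact rectangle, where the modulus of [F] has a maximum; so
    [F] is bounded. *)
Lemma liouville_periodic F (A B : R) : 0 < A -> 0 < B ->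
  (forall z, F (z + A%:C) = F z) -> (forall z, F (z + B *i) = F z) ->
  (forall z, has_jet 4 (fun t => F (z + t))) -> forall z, F z = F 0.
Proof.
move=> A0 B0 hA hB hF.
have [|z0 _ hmax] := @rectangle_EVT (fun z => nc (F z)) A B (ltW A0) (ltW B0).
  move=> z e e0; have [d d0 hd] := jet_cont (jetW (isT : (1 <= 4)%N) (hF z)) e0.
  exists d => // t /hd; rewrite addr0 => h /=; rewrite (le_trans _ h)// ler_norml.
  have := nc_gtB (F z) (F z - F (z + t)); rewrite addrC.
  have := nc_gtB (F (z + t)) (F (z + t) - F z).
  have := le_normcD (F z) (F (z + t) - F z).
  have := le_normcD (F (z + t)) (F z - F (z + t)).
  have := nc_distC (F z) (F (z + t)).
  rewrite ![_ + (_ - _)]addrC !subrK => -> ? ? _ _; apply/andP; split; lra.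
apply: (@liouville_bounded F (nc (F z0)) hF) => z.
rewrite -(periodicZ hA (- Num.floor (Re z / A))).
rewrite -(periodicZ hB (- Num.floor (Im z / B))).
have red (x C : R) : 0 < C -> `|x + C *~ - Num.floor (x / C)| <= C.
  move=> C0; have /andP[] := floor_itv (x / C).
  rewrite ler_pdivlMr// ltr_pdivrMr// intrD mulrDl mul1r mulrNz -mulrzl => h1 h2.
  by rewrite ler_norml; apply/andP; split; lra.
apply: hmax; rewrite !(ReD, ImD, Re_mulz, Im_mulz) /= ?mul0rz ?addr0; exact: red.
Qed.

End Liouville.

(** * Lattice sums and their expansions *)

Section BinomialJet.
Variable R : realType.
Local Notation C := R[i].

(* The Taylor coefficients of [(1 + t)^-k]. *)
Definition negbin (k j : nat) : C := (-1) ^+ j * 'C((k + j).-1, j)%:R.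

Lemma negbin_pascal k j : negbin k.+1 j.+1 + negbin k.+1 j = negbin k j.+1.
Proof.
rewrite /negbin !addnS /= addSn /= binS natrD exprS; ring.
Qed.

Lemma negbin0 k : negbin k 0 = 1.
Proof. by rewrite /negbin expr0 bin0 mul1r. Qed.

(** By Pascal's rule, multiplying the truncated series of [(1 + t) ^- k.+1] by [1 + t] gives that of
    [(1 + t) ^- k], up to one boundary term. *)
Lemma negbin_sum k n (t : C) :
  (1 + t) * (\sum_(j < n.+1) negbin k.+1 j * t ^+ j) =
  \sum_(j < n.+1) negbin k j * t ^+ j + negbin k.+1 n * t ^+ n.+1.
Proof.
elim: n => [|n IH]; first by rewrite !big_ord1 !negbin0; ring.
rewrite big_ord_recr mulrDr IH [in RHS]big_ord_recr /=.
have -> : negbin k n.+1 = negbin k.+1 n.+1 + negbin k.+1 n by rewrite negbin_pascal.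
move: (\sum_(_ < _) _) (negbin _ _) (negbin _ _) => S a b.
rewrite !exprS; ring.
Qed.

(** Induction on [k]: by [negbin_sum] the error for [k.+1] is the error for [k], corrected by a
    multiple of [t ^+ n.+1], over [1 + t]. *)
Lemma binomial_jet k n :
  isO n.+1 (fun t : C => (1 + t) ^- k - \sum_(j < n.+1) negbin k j * t ^+ j).
Proof.
have one0 (t : C) : nc t < 1 / 2 -> 1 / 2 <= nc (1 + t).
  by have := nc_gtB 1 t; rewrite Normc.normc1; lra.
have one1 (t : C) : nc t < 1 / 2 -> 1 + t != 0.
  by move=> /one0 h; rewrite -nc_gt0; lra.
elim: k => [|k IH].
  apply: (isO_ext _ (isOMX n.+1 (isO_cst 0))) => t _.
  rewrite mulr0 expr0 invr1 big_ord_recl negbin0 expr0 mulr1 big1 ?addr0 ?subrr//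
    => j _.
  by rewrite /negbin add0n /= bin_small ?mulr0 ?mul0r.
have b1 : isO 0 (fun t : C => (1 + t)^-1).
  exists 2, (1 / 2); split=> // t _ /one0 h;
    rewrite expr0 mulr1 Normc.normcV -[2]invrK lef_pV2 ?posrE; lra.
have := isOM b1 (isOD IH (isON (isOM (isO_cst (negbin k.+1 n)) (isOX R n.+1)))).
rewrite !add0n; apply: (@isO_near _ _ _ _ (1 / 2)); first by rewrite divr_gt0.
move=> t t0 /one1 h; apply: (mulfI h); rewrite mulrA divff// mul1r.
by rewrite mulrBr negbin_sum [(1
  + t) ^+ k.+1]exprS invfM mulrA divff// mul1r opprD addrA.
Qed.

End BinomialJet.

Section Lattice.
Variables (R : realType) (A B : R).
Hypotheses (A0 : A != 0) (B0 : B != 0).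
Local Notation C := R[i].
Implicit Types (z t : C) (k n : nat).

Definition om (i j : int) : C := (i%:~R * A) +i* (j%:~R * B).
Definition lat z := exists i j, z = om i j.

Lemma om_inj0 i j : (om i j == 0) = (i == 0) && (j == 0).
Proof. by rewrite eq_complex /= !mulf_eq0 (negPf A0) (negPf B0) !orbF !intr_eq0. Qed.

Lemma omD i j i' j' : om (i + i') (j + j') = om i j + om i' j'.
Proof. by apply/eqP; rewrite eq_complex /= !intrD !mulrDl !eqxx. Qed.

Lemma omN i j : om (- i) (- j) = - om i j.
Proof. by apply/eqP; rewrite eq_complex /= !intrN !mulNr !eqxx. Qed.

Lemma latD z w : lat z -> lat w -> lat (z + w).
Proof. by move=> [i [j ->]] [i' [j' ->]]; exists (i + i'), (j + j'); rewrite omD. Qed.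

Lemma latN z : lat z -> lat (- z).
Proof. by move=> [i [j ->]]; exists (- i), (- j); rewrite omN. Qed.

Lemma lat0 : lat 0.
Proof. by exists 0, 0; apply/eqP; rewrite eq_sym om_inj0. Qed.

Lemma omA : om 1 0 = A%:C. Proof. by rewrite /om mul1r mul0r. Qed.
Lemma omB : om 0 1 = B *i. Proof. by rewrite /om mul1r mul0r. Qed.

(** Beyond the threshold [T] the distance to [z] grows linearly with the index. Only finitely many
    lattice points remain, and [S] exceeds each of their ratios of weight to distance. *)
Lemma lat_separated z : exists2 c : R, 0 < c &
  forall i j, z != om i j -> c * box_wt R i j <= nc (z - om i j).
Proof.
pose m := Num.min `|A| `|B| / 2.
have m0 : 0 < m by rewrite divr_gt0// lt_min !normr_gt0 A0.
have hm i j : m * (box_wt R i j - 1) <= nc (om i j).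
  have hA : 2 * m <= `|A| by rewrite mulrC divfK// ge_min lexx.
  have hB : 2 * m <= `|B| by rewrite mulrC divfK// ge_min lexx orbT.
  have -> : box_wt R i j - 1 = `|i|%:~R + `|j|%:~R.
    by rewrite /box_wt -natr1 addrK natrD !pmulrn !abszE.
  have := Re_le_nc (om i j); have := Im_le_nc (om i j); rewrite /= !normrM !intr_norm.
  have := normr_ge0 (i%:~R : R); have := normr_ge0 (j%:~R : R).
  move: `|i%:~R| `|j%:~R| => x y x0 y0 h1 h2; nra.
pose T := (nc z + m) * 2 / m.
pose n := (Num.truncn T).+1.
have large i j : T <= box_wt R i j -> m / 2 * box_wt R i j <= nc (z - om i j).
  rewrite /T ler_pdivrMr// => h; have := hm i j; have := nc_gtB (om i j) (- z).
  by rewrite normcN nc_distC => h1 h2; clear -m0 h h1 h2; nra.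
pose F (p : 'I_n.*2.+1 * 'I_n.*2.+1) : R :=
  box_wt R (p.1%:Z - n%:Z) (p.2%:Z - n%:Z) / nc (z - om (p.1%:Z - n%:Z) (p.2%:Z
    - n%:Z)).
have F0 p : 0 <= F p by rewrite divr_ge0// ?nc_ge0// ltW// box_wt_gt0.
pose S := \sum_p F p + 1.
have S0 : 0 < S by rewrite ltr_wpDl// sumr_ge0.
exists (Num.min (m / 2) S^-1); first by rewrite lt_min divr_gt0//= invr_gt0.
move=> i j zij; have muij := box_wt_gt0 R i j.
have [h|h] := leP T (box_wt R i j).
  by rewrite (le_trans _ (large _ _ h))// ler_wpM2r ?(ltW muij)// ge_min lexx.
apply: (@le_trans _ _ (S^-1 * box_wt R i j)).
  by rewrite ler_wpM2r ?(ltW muij)// ge_min lexx orbT.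
have nz : 0 < nc (z - om i j) by rewrite nc_gt0 subr_eq0.
rewrite mulrC ler_pdivrMr// mulrC -ler_pdivrMr//.
have hn : (`|i| + `|j| < n)%N.
  by have := lt_trans h (truncnS_gt T); rewrite /box_wt ltr_nat; apply: leq_trans.
have b1 : (absz (i + n%:Z)%R < n.*2.+1)%N by clear -hn; lia.
have b2 : (absz (j + n%:Z)%R < n.*2.+1)%N by clear -hn; lia.
pose p : 'I_n.*2.+1 * 'I_n.*2.+1 := (Ordinal b1, Ordinal b2).
have -> : box_wt R i j / nc (z - om i j) = F p.
  rewrite /F /=; have -> : (absz (i + n%:Z))%:Z - n%:Z = i :> int by clear -hn; lia.
  by have -> : (absz (j + n%:Z))%:Z - n%:Z = j :> int by clear -hn; lia.
by rewrite /S (bigD1 p)//= -addrA lerDl addr_ge0// sumr_ge0.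
Qed.

(* As [0^-1 = 0], the term of the lattice point [z] itself (if there is one) is dropped:
   [eis k z] is the sum of [(z - w)^-k] with its pole removed, [eis 2] is the Weierstrass
   function, [-2 * eis 3] its derivative and [6 * eis 4] its second derivative, and
   [eis k 0] is the Eisenstein series [G_k]. *)
Definition eis_term k z (i j : int) : C :=
  (z - om i j) ^- k - (if k == 2%N then om i j ^- 2 else 0).
Definition eis k z : C := box_lim (eis_term k z).

Lemma pow_bound k z : (0 < k)%N -> exists2 c : R, 0 <= c &
  forall i j, nc ((z - om i j) ^- k) <= c / box_wt R i j ^+ k.
Proof.
move=> k0; have [c c0 hc] := lat_separated z; exists (c ^- k).
  by rewrite invr_ge0 exprn_ge0// ltW.
move=> i j; have m0 := box_wt_gt0 R i j.
have [<-|zij] := eqVneq z (om i j).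
  by rewrite subrr expr0n (gtn_eqF k0) invr0 Normc.normc0 divr_ge0 ?invr_ge0
    ?exprn_ge0// ltW.
rewrite Normc.normcV ncX -invfM -exprMn lef_pV2 ?posrE ?exprn_gt0 ?mulr_gt0//.
  by rewrite lerXn2r ?nnegrE ?hc ?nc_ge0// mulr_ge0 ?ltW.
by rewrite nc_gt0 subr_eq0.
Qed.

Lemma eis_bound k z : (1 < k)%N -> exists2 c : R, 0 <= c &
  forall i j, nc (eis_term k z i j) <= c / box_wt R i j ^+ 3.
Proof.
rewrite leq_eqVlt => /orP[/eqP <-|k2]; last first.
  have [c c0 hc] := pow_bound z (ltnW (ltnW k2)); exists c => // i j.
  rewrite /eis_term gtn_eqF// subr0 (le_trans (hc i j))// ler_wpM2l//.
  rewrite lef_pV2 ?posrE ?exprn_gt0 ?box_wt_gt0//.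
  by rewrite ler_weXn2l// box_wt_ge1.
have [c c0 hc] := lat_separated z; have [d d0 hd] := lat_separated 0.
pose e := Num.min c d.
have e0 : 0 < e by rewrite lt_min c0.
have {}hc i j : z != om i j -> e * box_wt R i j <= nc (z - om i j).
  move=> /hc; apply: le_trans; rewrite ler_wpM2r ?(ltW (box_wt_gt0 _ _ _))//.
  by rewrite ge_min lexx.
have {}hd i j : om i j != 0 -> e * box_wt R i j <= nc (om i j).
  rewrite eq_sym => /hd; rewrite sub0r normcN; apply: le_trans.
  by rewrite ler_wpM2r ?(ltW (box_wt_gt0 _ _ _))// ge_min lexx orbT.
have z0 := nc_ge0 z.
have c1 : 0 <= 3 * nc z * e ^- 3 by rewrite !mulr_ge0 ?invr_ge0 ?exprn_ge0 ?(ltW e0).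
(* The second summand serves the origin, whose term is [z ^- 2] with weight 1; the first serves all
   other lattice points. *)
exists (3 * nc z * e ^- 3 + nc (z ^- 2)).
  by rewrite addr_ge0 ?nc_ge0.
move=> i j; have m0 := box_wt_gt0 R i j; rewrite /eis_term /=.
have i3 : 0 < box_wt R i j ^+ 3 by rewrite exprn_gt0.
have [/eqP|w0] := eqVneq (om i j) 0.
  rewrite om_inj0 => /andP[/eqP -> /eqP ->].
  have /eqP -> : om 0 0 == 0 by rewrite om_inj0.
  by rewrite subr0 expr0n invr0 subr0 /box_wt expr1n divr1 lerDr.
have nz2 := nc_ge0 (z ^- 2).
suff h3 : nc ((z - om i j) ^- 2 - om i j ^- 2) <= 3 * nc z * e ^- 3 / box_wt R i j ^+ 3.
  by rewrite (le_trans h3)// ler_wpM2r ?invr_ge0 ?(ltW i3)// lerDl.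
pose a := (e * box_wt R i j)^-1.
have a0 : 0 < a by rewrite invr_gt0 mulr_gt0.
have -> : 3 * nc z * e ^- 3 / box_wt R i j ^+ 3 = 3 * nc z * a ^+ 3.
  by rewrite /a -mulrA -invfM -exprMn exprVn.
have le_a (w : C) : w != 0 -> e * box_wt R i j <= nc w -> nc w^-1 <= a.
  by move=> wn0 h; rewrite Normc.normcV lef_pV2 ?posrE ?nc_gt0// mulr_gt0.
have y1 := le_a _ w0 (hd _ _ w0); have y0 := nc_ge0 (om i j)^-1.
have [zw|zw] := eqVneq z (om i j).
  rewrite zw subrr expr0n invr0 sub0r normcN -zw.
  have w1 : z != 0 by rewrite zw.
  have -> : z ^- 2 = z * z^-1 ^+ 3 by field.
  rewrite Normc.normcM ncX zw.
  have y3 : nc (om i j)^-1 ^+ 3 <= a ^+ 3 by rewrite lerXn2r ?nnegrE// ltW.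
  have := ler_wpM2l z0 y3; rewrite -zw.
  have : 0 <= nc z * a ^+ 3 by rewrite mulr_ge0// exprn_ge0// ltW.
  lra.
have v0 : z - om i j != 0 by rewrite subr_eq0.
have x1 := le_a _ v0 (hc _ _ zw); have x0 := nc_ge0 (z - om i j)^-1.
(* With [x] and [y] the inverses of [z - om i j] and [om i j], one has [x + y = z * x * y]; so the
   difference of squares is cubic in [x] and [y], which gains the third power of the weight. *)
have -> : (z - om i j) ^- 2 - om i j ^- 2 =
   z * ((z - om i j)^-1 ^+ 2 * (om i j)^-1 - (z - om i j)^-1 * (om i j)^-1 ^+ 2).
  by field; apply/andP.
rewrite Normc.normcM [3 * _]mulrC -[_ * 3 * _]mulrA ler_wpM2l//.
rewrite (le_trans (ncB _ _))//.
rewrite Normc.normcM [nc (_^-1 ^+ 2)]ncX [nc (_ * _ ^+ 2)]Normc.normcM [nc (_^-1 ^+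
  2)]ncX.
move: x0 x1 y0 y1; move: (nc _) (nc _) => x y x0 x1 y0 y1.
have l1 : x ^+ 2 * y <= a ^+ 3.
  by rewrite [a ^+ 3]exprSr ler_pM ?exprn_ge0// lerXn2r ?nnegrE// ltW.
have l2 : x * y ^+ 2 <= a ^+ 3.
  by rewrite [a ^+ 3]exprS ler_pM ?exprn_ge0// lerXn2r ?nnegrE// ltW.
have : 0 <= a ^+ 3 by rewrite exprn_ge0// ltW.
lra.
Qed.

Lemma eisP k z : (1 < k)%N -> box_cvg (eis_term k z) (eis k z).
Proof.
move=> k1; have [c c0 hc] := eis_bound z k1; have [L [hL _]] := box_cvg_exists c0 hc.
by rewrite /eis (box_limE hL).
Qed.

Lemma eis_eq k z L : box_cvg (eis_term k z) L -> eis k z = L.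
Proof. exact: box_limE. Qed.

(** The period shifts the index in [(z - om i j) ^- k] but not in the correction [om i j ^- 2]. The
    terms at [z] and [z + A%:C] thus differ by [f (i + 1) j - f i j], which sums to [0]. The dropped
    term shifts along with the index. *)
Lemma eis_periodA k z : (1 < k)%N -> eis k (z + A%:C) = eis k z.
Proof.
move=> k1; pose f i j := (z + A%:C - om i j) ^- k.
have [c c0 hc] := pow_bound (z + A%:C) (ltnW k1).
have h0 : box_cvg (fun i j => f (i + 1) j - f i j) 0.
  apply: (box_cvg_shift1 c0) => i j; rewrite (le_trans (hc i j))// ler_wpM2l//.
  by rewrite lef_pV2 ?posrE ?exprn_gt0 ?box_wt_gt0// ler_weXn2l// box_wt_ge1.
apply/esym/eis_eq; rewrite -[eis _ _]addr0.
apply: (eq_box_cvg _ (box_cvgD (eisP (z + A%:C) k1) h0)) => N.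
apply: eq_box_sum => i j; rewrite /eis_term /f.
have -> : z + A%:C - om (i + 1) j = z - om i j.
  by rewrite -[j in om (i + 1) j]addr0 omD omA; ring.
ring.
Qed.

Lemma eis_periodB k z : (1 < k)%N -> eis k (z + B *i) = eis k z.
Proof.
move=> k1; pose f i j := (z + B *i - om i j) ^- k.
have [c c0 hc] := pow_bound (z + B *i) (ltnW k1).
have h0 : box_cvg (fun i j => f i (j + 1) - f i j) 0.
  apply: (box_cvg_shift2 c0) => i j; rewrite (le_trans (hc i j))// ler_wpM2l//.
  by rewrite lef_pV2 ?posrE ?exprn_gt0 ?box_wt_gt0// ler_weXn2l// box_wt_ge1.
apply/esym/eis_eq; rewrite -[eis _ _]addr0.
apply: (eq_box_cvg _ (box_cvgD (eisP (z + B *i) k1) h0)) => N.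
apply: eq_box_sum => i j; rewrite /eis_term /f.
have -> : z + B *i - om i (j + 1) = z - om i j.
  by rewrite -[i in om i (j + 1)]addr0 omD omB; ring.
ring.
Qed.

Lemma eisN k z : (1 < k)%N -> eis k (- z) = (-1) ^+ k * eis k z.
Proof.
move=> k1; apply: eis_eq; apply: (eq_box_cvg _ (box_cvgZ ((-1) ^+ k) (eisP z k1))) => N.
rewrite -[RHS]box_sumN1 -[RHS]box_sumN2; apply: eq_box_sum => i j.
rewrite /eis_term omN opprK.
have -> : - z + om i j = - (z - om i j) by ring.
rewrite [(- (z - _)) ^+ k]exprNn (invfM ((-1) ^+ k)) -[((-1) ^+ k)^-1]exprVn
  invrN1; case: ifP => [/eqP ->|_].
  by rewrite !sqrrN expr1n !mul1r.
by rewrite !subr0.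
Qed.

Lemma conj_om i j : conjc (om i j) = om i (- j).
Proof. by rewrite /om /= intrN mulNr. Qed.

(** Conjugation permutes a rectangular lattice by [j |-> - j], which preserves the squares of
    summation. *)
Lemma eis_conj k z : (1 < k)%N -> eis k (conjc z) = conjc (eis k z).
Proof.
move=> k1; apply: eis_eq; apply: (eq_box_cvg _ (box_cvg_conj (eisP z k1))) => N.
rewrite -[RHS]box_sumN2; apply: eq_box_sum => i j; rewrite /eis_term.
have cB (u v : C) : conjc (u - v) = conjc u - conjc v by rewrite [LHS]rmorphB.
have cV (u : C) m : conjc (u ^- m) = (conjc u) ^- m by rewrite [LHS]fmorphV [X in
  X^-1]rmorphXn.
rewrite [LHS]cB; congr (_ - _); first by rewrite cV cB conj_om.
by case: ifP => _; rewrite ?conjc0// cV conj_om.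
Qed.

Lemma eis0_odd k : (1 < k)%N -> odd k -> eis k 0 = 0.
Proof.
move=> k1 ok; have := eisN 0 k1; rewrite oppr0 -signr_odd ok mulN1r => h.
have : eis k 0 * 2 = 0 by rewrite mulr_natr mulr2n {1}h addNr.
by move/eqP; rewrite mulf_eq0 pnatr_eq0 orbF => /eqP.
Qed.

(** Each term [(W + t) ^- k] is expanded in [t / W], and since [nc W] is at least [c] times the
    weight, the remainders are summable uniformly in [t]. The only term with [W = 0] is that of the
    origin when [z = 0]; it yields the pole. *)
Lemma eis_expand k n z (pole : C -> C) :
  (forall t, pole t = if z == 0 then t ^- k else 0) -> z = 0 \/ ~ lat z -> (1 < k)%N ->
  exists2 u, isO 0 u & forall t, t != 0 -> eis k (z + t) = pole t +
    \sum_(j < n.+1) negbin R k j * t ^+ j * eis (k + j) z + t ^+ n.+1 * u t.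
Proof.
move=> hpole hz k1.
pose P t := pole t + \sum_(j < n.+1) negbin R k j * t ^+ j * eis (k + j) z.
suff h : isO n.+1 (fun t => eis k (z + t) - P t).
  exists (fun t => (eis k (z + t) - P t) / t ^+ n.+1);
    first exact: (isO_div (n := 0) h).
  by move=> t t0; rewrite -/(P t) mulrC divfK ?expf_neq0//; ring.
have [K [d [K0 d0 hK]]] := binomial_jet R k n.
have [c c0 hc] := lat_separated z.
pose M := 33 * (K * c ^- (k + n.+1)).
exists M, (Num.min (d * c) c); split.
- by rewrite !mulr_ge0// invr_ge0 exprn_ge0// ltW.
- by rewrite lt_min mulr_gt0//.
move=> t t0; rewrite lt_min => /andP[tdc tc].
pose W i j := z - om i j.
pose r i j : C := if W i j == 0 then 0 else
  W i j ^- k * ((1 + t / W i j) ^- k -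
     \sum_(m < n.+1) negbin R k m * (t / W i j) ^+ m).
have rb i j : nc (r i j) <= (K * c ^- (k + n.+1) * nc t ^+ n.+1) / box_wt R i j ^+ 3.
  have m0 := box_wt_gt0 R i j; have m1 := box_wt_ge1 R i j; rewrite /r;
    case: eqVneq => [_|Wn0].
    rewrite Normc.normc0 !mulr_ge0// ?invr_ge0 ?exprn_ge0 ?nc_ge0// ltW//.
  have hW : c * box_wt R i j <= nc (W i j) by apply: hc; rewrite -subr_eq0.
  have cW : c <= nc (W i j) by rewrite (le_trans _ hW)// ler_pMr.
  have W0 : 0 < nc (W i j) by rewrite nc_gt0.
  have tW : nc (t / W i j) < d.
    rewrite Normc.normcM Normc.normcV ltr_pdivrMr// (lt_le_trans tdc)//.
    by rewrite ler_wpM2l// ltW.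
  have tW0 : t / W i j != 0 by rewrite mulf_neq0// invr_eq0.
  have h := hK _ tW0 tW; rewrite Normc.normcM Normc.normcV ncX.
  rewrite (le_trans (ler_wpM2l _ h))// ?invr_ge0 ?exprn_ge0 ?nc_ge0//.
  rewrite Normc.normcM Normc.normcV exprMn.
  have -> : (nc (W i j) ^+ k)^-1 * (K * (nc t ^+ n.+1 * (nc (W i j))^-1 ^+ n.+1))
    = K * nc t ^+ n.+1 * nc (W i j) ^- (k + n.+1).
    rewrite exprD invfM exprVn.
    by move: (nc t ^+ _) (nc (W i j) ^- k) (nc (W i j) ^- n.+1) => x y w; ring.
  have -> : K * c ^- (k + n.+1) * nc t ^+ n.+1 / box_wt R i j ^+ 3 =
    K * nc t ^+ n.+1 * (c ^- (k + n.+1) / box_wt R i j ^+ 3).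
    by rewrite mulrA; congr (_ * _); rewrite mulrAC.
  rewrite ler_wpM2l ?mulr_ge0 ?exprn_ge0 ?nc_ge0//.
  rewrite -invfM lef_pV2 ?posrE ?mulr_gt0 ?exprn_gt0//.
  apply: (@le_trans _ _ ((c * box_wt R i j) ^+ (k + n.+1))).
    rewrite exprMn ler_wpM2l ?exprn_ge0 ?(ltW c0)// ler_weXn2l//.
    by rewrite addnS ltnS ltn_addr.
  by rewrite lerXn2r ?nnegrE ?nc_ge0// mulr_ge0// ltW.
have rc0 : 0 <= K * c ^- (k + n.+1) * nc t ^+ n.+1.
  by rewrite !mulr_ge0// ?invr_ge0 ?exprn_ge0 ?nc_ge0// ltW.
have [L [hL nL]] := box_cvg_exists rc0 rb.
suff -> : eis k (z + t) - P t = L.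
  by rewrite (le_trans nL)// /M -!mulrA.
suff -> : eis k (z + t) = P t + L by ring.
apply: eis_eq; rewrite /P.
have hdelta : box_cvg (fun i j => if (i == 0) && (j == 0) then pole t else 0) (pole t).
  by apply: box_cvg_cst => N; rewrite box_sum_delta.
have hsum : box_cvg (fun i j => \sum_(m < n.+1) negbin R k m * t ^+ m * eis_term (k
  + m) z i j)
    (\sum_(m < n.+1) negbin R k m * t ^+ m * eis (k + m) z).
  by apply: (@box_cvg_sum _ _ (fun m i j =>
    negbin R k m * t ^+ m * eis_term (k + m) z i j)
    (fun m => negbin R k m * t ^+ m * eis (k + m) z)) => m _; apply: box_cvgZ;
      exact/eisP/ltn_addr.
apply: (eq_box_cvg _ (box_cvgD (box_cvgD hdelta hsum) hL)) => N.
apply: eq_box_sum => i j; rewrite /eis_term.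
(* As [1 < k], the index [k + m] equals 2 only for [k = 2] and [m = 0], so the correction enters
   exactly once. *)
have e1 : \sum_(m < n.+1) negbin R k m * t ^+ m *
     ((z - om i j) ^- (k + m) - (if (k + m)%N == 2%N then om i j ^- 2 else 0)) =
   W i j ^- k * (\sum_(m < n.+1) negbin R k m * (t / W i j) ^+ m)
    - (if k == 2%N then om i j ^- 2 else 0).
  rewrite mulr_sumr !big_ord_recl !addn0 !negbin0 !expr0 !mul1r mulr1 -/(W i j).
  have -> : \sum_(m < n) negbin R k (lift ord0 m) * t ^+ lift ord0 m *
     (W i j ^- (k + lift ord0 m) -
      (if (k + lift ord0 m)%N == 2%N then om i j ^- 2 else 0)) =
    \sum_(m < n) W i j ^- k * (negbin R k (lift ord0 m) * (t / W i j) ^+ lift ord0 m).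
    apply: eq_bigr => m _; rewrite ifF ?subr0.
      by rewrite exprD invfM exprMn exprVn; ring.
    by rewrite lift0 gtn_eqF// addnS ltnS ltn_addr.
  by rewrite addrAC.
rewrite e1 /r; case: (eqVneq (W i j) 0) => [W0|Wn0].
  have zom : z = om i j by apply/eqP; rewrite -subr_eq0; apply/eqP.
  have z0 : z = 0 by case: hz => // h; case: h; exists i, j.
  have i0 : (i == 0) && (j == 0) by rewrite -om_inj0 -zom z0.
  rewrite i0 hpole z0 eqxx add0r.
  have -> : om i j = 0 by rewrite -zom.
  by rewrite W0 expr0n gtn_eqF ?(ltnW k1)// invr0 mul0r subr0 addr0; ring.
have -> : (if (i == 0) && (j == 0) then pole t else 0) = 0.
  case: ifP => // h; rewrite hpole ifF//; apply/negbTE.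
  by move: Wn0; rewrite /W; move: h; rewrite -om_inj0 => /eqP ->; rewrite subr0.
have -> : z + t - om i j = W i j * (1 + t / W i j).
  by rewrite mulrDr mulr1 mulrCA divff// mulr1 /W; ring.
rewrite exprMn (invfM (W i j ^+ k)).
by move: (_ ^- k) (_ ^- k) (\sum_(_ < _) _) (if _ then _ else _) => x y S w; ring.
Qed.

End Lattice.

Section JetExtras.
Variable R : realType.
Local Notation C := R[i].

Lemma isO_opp n (f : C -> C) : isO n f -> isO n (fun t => f (- t)).
Proof.
move=> [c [d [c0 d0 h]]]; exists c, d; split=> // t t0 td.
by rewrite -[nc t]normcN h ?oppr_eq0 ?normcN.
Qed.

Lemma eq_sub0 (x y p : C) : p = 0 -> x - y = p -> x = y.
Proof. by move=> -> /eqP; rewrite subr_eq0 => /eqP. Qed.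

Lemma isO_id0 : isO 0 (id : C -> C).
Proof. exact: (isOW (leq0n 1) (isO_id R)). Qed.

Lemma isO1_cst (a : C) : isO 1 (fun=> a) -> a = 0.
Proof.
move=> h; apply/eqP; rewrite -nc_eq0; apply: contraT => a0.
have a1 : 0 < nc a / 2 by rewrite divr_gt0// lt_def a0 nc_ge0.
have [d d0 hd] := isO_sub h a1.
have d2 : 0 < d / 2 by rewrite divr_gt0.
have := hd (d / 2)%:C; rewrite -nc_gt0 nc_real gtr0_norm// d2 => /(_ isT).
have -> : d / 2 < d by lra.
by move=> /(_ isT); lra.
Qed.

(** Serves to compare Taylor coefficients in an identity that holds only on a punctured disc. *)
Lemma isO_quad_eq0 (c1 c2 : C) (b : C -> C) (d : R) : 0 < d -> isO 0 b ->
  (forall t, t != 0 -> nc t < d -> c1 * t + c2 * t ^+ 2 + t ^+ 3 * b t = 0) ->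
  c1 = 0 /\ c2 = 0.
Proof.
move=> d0 hb h.
have h1 : c1 = 0.
  apply: isO1_cst.
  apply: (@isO_near _ _ (fun t => t ^+ 1 * (- c2 - t * b t)) _ d d0); last first.
    by apply: isOMX; apply: isOD; [exact: isO_cst|apply: isON; apply: isOM0 => //;
      exact: isO_id0].
  move=> t t0 td; apply: (mulIf t0); apply/esym.
  by apply: (eq_sub0 (h t t0 td)); ring.
split=> //; apply: isO1_cst.
apply: (@isO_near _ _ (fun t => t ^+ 1 * (- b t)) _ d d0); last first.
  by apply: isOMX; exact: isON.
move=> t t0 td; apply: (mulIf (expf_neq0 2 t0)); have := h t t0 td.
rewrite h1 mul0r add0r => e.
by apply/esym; apply: (eq_sub0 e); ring.
Qed.

Lemma negbin_val k j m : 'C((k + j).-1, j) = m -> negbin R k j = (-1) ^+ j * m%:R.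
Proof. by move=> <-. Qed.

End JetExtras.

Ltac isO0_tac := lazymatch goal with
  | |- isO 0 (fun t => @?f t + @?g t) => apply: (@isOD _ 0 f g); isO0_tac
  | |- isO 0 (fun t => - @?f t) => apply: (@isON _ 0 f); isO0_tac
  | |- isO 0 (fun t => @?f t * @?g t) => apply: (@isOM0 _ f g); isO0_tac
  | |- isO 0 (fun t => @?f t ^+ ?n) => apply: (@isO_exp0 _ n f); isO0_tac
  | |- isO 0 (fun t => t) => exact: isO_id0
  | |- _ => first [exact: isO_cst | assumption]
  end.

(** * The Weierstrass function and its 3-torsion values *)

Section Elliptic.
Variables (R : realType) (A B : R).
Hypotheses (A0 : 0 < A) (B0 : 0 < B).
Local Notation C := R[i].
Local Notation E := (eis A B).
Local Notation lat := (lat A B).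
Local Notation om := (om A B).
Implicit Types (z t : C) (f : C -> C).
Let An0 : A != 0 := lt0r_neq0 A0.
Let Bn0 : B != 0 := lt0r_neq0 B0.

Lemma omE i j : om i j = A%:C *~ i + (B *i) *~ j.
Proof.
by apply/eqP; rewrite eq_complex /= ReD ImD !(Re_mulz,
  Im_mulz) /= !mul0rz addr0 add0r !mulrzl !eqxx.
Qed.

Lemma periodic_om f : (forall z, f (z + A%:C) = f z) -> (forall z, f (z
  + B *i) = f z) ->
  forall i j z, f (z + om i j) = f z.
Proof. by move=> hA hB i j z; rewrite omE addrA periodicZ// periodicZ. Qed.

Lemma lat_discrete z : exists2 d : R, 0 < d &
  forall t, t != 0 -> nc t < d -> ~ lat (z + t).
Proof.
have [c c0 hc] := lat_separated An0 Bn0 z; exists c => // t t0 tc [i [j e]].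
have zt : z - (z + t) = - t by ring.
have zo : z != om i j by rewrite -e -subr_eq0 zt oppr_eq0.
have := hc i j zo; rewrite -e zt normcN => h.
by have := box_wt_ge1 R i j; move: h tc; have := box_wt_gt0 R i j; nra.
Qed.

Lemma eis_J k n z : (1 < k)%N -> ~ lat z -> has_jet n.+1 (fun t => E k (z + t)).
Proof.
move=> k1 hz; have z0 : z != 0 by apply: contra_notN hz => /eqP ->; exact: lat0.
have [|u hu e] := @eis_expand R A B An0 Bn0 k n z (fun=> 0) _ (or_intror hz) k1.
  by move=> t; rewrite (negPf z0).
exists (\poly_(j < n.+1) (negbin R k j * E (k + j) z)); split.
  rewrite addr0 horner_poly big_ord_recl expr0 mulr1 negbin0 mul1r addn0.
  by rewrite big1 ?addr0// => j _; rewrite lift0 expr0n mulr0.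
apply: (isO_ext _ (isOMX n.+1 hu)) => t t0; rewrite e// horner_poly add0r addrAC.
rewrite (eq_bigr (fun j : 'I_n.+1 =>
  negbin R k j * E (k + j) z * t ^+ j)) ?subrr ?add0r// => j _.
by rewrite mulrAC.
Qed.

(** The value of [f] on the lattice carries no information, so it is replaced by the constant term
    of the expansion at [0]; periodicity carries this expansion to every lattice point. *)
Lemma liouville_elliptic f (c : C) (p : {poly C}) :
  (forall z, f (z + A%:C) = f z) -> (forall z, f (z + B *i) = f z) ->
  (forall z, ~ lat z -> has_jet 4 (fun t => f (z + t))) ->
  p.[0] = c -> isO 4 (fun t => f t - p.[t]) -> forall z, ~ lat z -> f z = c.
Proof.
move=> hA hB hJ pc hp.
pose F z := if `[< lat z >] then c else f z.
have FN z : ~ lat z -> F z = f z by move=> h; rewrite /F asboolF.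
have latA : lat A%:C by exists 1, 0; rewrite omA.
have latB : lat (B *i) by exists 0, 1; rewrite omB.
have FA z w : lat w -> (forall z, f (z + w) = f z) -> F (z + w) = F z.
  move=> hw fw; rewrite /F fw; congr (if _ then _ else _); apply: asbool_equiv_eq.
  split=> h; last exact: latD.
  by rewrite -(addrK w z); apply: latD => //; exact: latN.
have FJ z : has_jet 4 (fun t => F (z + t)).
  have [[i [j ->]]|hz] := pselect (lat z).
    have [d d0 hd] := lat_discrete 0.
    exists p; split; first by rewrite addr0 /F asboolT ?pc//; exists i, j.
    apply: (isO_near d0 _ hp) => t t0 td.
    rewrite [om i j + t]addrC FA; [|by exists i, j|exact: periodic_om].
    by rewrite FN// -[t]add0r; exact: hd.
  have [d d0 hd] := lat_discrete z.
  apply: (jet_near d0 _ (hJ z hz)) => t td; rewrite FN//.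
  by have [->|t0] := eqVneq t 0; [rewrite addr0|exact: hd].
move=> z hz; rewrite -FN// (@liouville_periodic R F A B)//.
- by rewrite /F asboolT//; exact: lat0.
- by move=> w; exact: FA.
- by move=> w; exact: FA.
Qed.

(** At [z = 0] the correction cancels every term, so this is not the conditionally convergent series
    of weight 2 but the vanishing constant term of p at its pole. *)
Lemma eis2_0 : E 2 0 = 0.
Proof.
apply: eis_eq; apply: box_cvg_cst => N.
rewrite /box_sum /seg_sum big1// => i _; rewrite big1// => j _.
by rewrite /eis_term /= sub0r sqrrN subrr.
Qed.

Local Notation G4 := (E 4 0).
Local Notation G6 := (E 6 0).
Local Notation G8 := (E 8 0).

Let odd0 k : (1 < k)%N -> odd k -> E k 0 = 0 := @eis0_odd R A B An0 Bn0 k.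

Lemma eis2_at0 : exists2 u : C -> C, isO 0 u & forall t, t != 0 ->
  E 2 t = t ^- 2 + 3 * G4 * t ^+ 2 + 5 * G6 * t ^+ 4 + 7 * G8 * t ^+ 6 + t ^+ 8 * u t.
Proof.
have [t|u hu e] := @eis_expand R A B An0 Bn0 2 7 0 (fun t =>
  t ^- 2) _ (or_introl erefl) isT.
  by rewrite eqxx.
exists u => // t t0; have := e t t0; rewrite add0r => ->.
rewrite !big_ord_recl big_ord0 /= /bump /= !addnE /=.
rewrite eis2_0 (@odd0 3)// (@odd0 5)// (@odd0 7)// (@odd0 9)//.
rewrite (@negbin_val R 2 2 3)// (@negbin_val R 2 4 5)// (@negbin_val R 2 6 7)//.
ring.
Qed.

Lemma eis3_at0 : exists2 u : C -> C, isO 0 u & forall t, t != 0 ->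
  E 3 t = t ^- 3 - 3 * G4 * t - 10 * G6 * t ^+ 3 - 21 * G8 * t ^+ 5 + t ^+ 7 * u t.
Proof.
have [t|u hu e] := @eis_expand R A B An0 Bn0 3 6 0 (fun t =>
  t ^- 3) _ (or_introl erefl) isT.
  by rewrite eqxx.
exists u => // t t0; have := e t t0; rewrite add0r => ->.
rewrite !big_ord_recl big_ord0 /= /bump /= !addnE /=.
rewrite (@odd0 3)// (@odd0 5)// (@odd0 7)// (@odd0 9)//.
rewrite (@negbin_val R 3 1 3)// (@negbin_val R 3 3 10)// (@negbin_val R 3 5 21)//.
ring.
Qed.

Lemma eis4_at0 : exists2 u : C -> C, isO 0 u & forall t, t != 0 ->
  E 4 t = t ^- 4 + G4 + 10 * G6 * t ^+ 2 + t ^+ 4 * u t.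
Proof.
have [t|u hu e] := @eis_expand R A B An0 Bn0 4 3 0 (fun t =>
  t ^- 4) _ (or_introl erefl) isT.
  by rewrite eqxx.
exists u => // t t0; have := e t t0; rewrite add0r => ->.
rewrite !big_ord_recl big_ord0 /= /bump /= !addnE /=.
rewrite (@odd0 5)// (@odd0 7)//.
rewrite (@negbin_val R 4 0 1)// (@negbin_val R 4 2 10)//.
ring.
Qed.

Lemma wp_second_derivative z : ~ lat z -> E 4 z = E 2 z ^+ 2 - 5 * G4.
Proof.
pose f z := E 4 z - E 2 z ^+ 2 + 5 * G4.
move=> hz; suff : f z = 0 by rewrite /f => h; apply: (eq_sub0 h); ring.
have [u hu e2] := eis2_at0; have [v hv e4] := eis4_at0.
apply: (@liouville_elliptic f 0 0) => //; rewrite /f.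
- by move=> w; rewrite !eis_periodA.
- by move=> w; rewrite !eis_periodB.
- move=> w hw; apply: jetD; last exact: jet_cst.
  by apply: jetB; [|apply: jetX]; exact: eis_J.
- by rewrite horner0.
(* The poles [t ^- 4] and the terms [10 * G6 * t ^+ 2] cancel, and the constants are
   [G4 - 6 * G4 + 5 * G4 = 0]. *)
apply: (isO_ext _ (isOMX 4 (_ : isO 0 (fun t => v t - 14 * G8 - 2 * (t ^+ 2 * u t) -
  (3 * G4 + 5 * G6 * t ^+ 2 + 7 * G8 * t ^+ 4 + t ^+ 6 * u t) ^+ 2))));
    last by isO0_tac.
move=> t t0; rewrite horner0 (e2 t t0) (e4 t t0).
by move: (E 4 0) (E 6 0) (E 8 0) (u t) (v t) => g4 g6 g8 ut vt; field.
Qed.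

Lemma wp_ode z : ~ lat z -> E 3 z ^+ 2 = E 2 z ^+ 3 - 15 * G4 * E 2 z - 35 * G6.
Proof.
pose f z := E 3 z ^+ 2 - E 2 z ^+ 3 + 15 * G4 * E 2 z + 35 * G6.
move=> hz; suff : f z = 0 by rewrite /f => h; apply: (eq_sub0 h); ring.
have [u hu e2] := eis2_at0; have [v hv e3] := eis3_at0.
(* Only the constant term of the polynomial is prescribed; the [t ^+ 2] coefficient is kept as it
   comes out of the expansion. *)
apply: (@liouville_elliptic f 0 ((27 * G4 ^+ 2 - 63 * G8)%:P * 'X^2)) => //; rewrite /f.
- by move=> w; rewrite !eis_periodA.
- by move=> w; rewrite !eis_periodB.
- move=> w hw; apply: jetD; last exact: jet_cst.
  apply: jetD; last by apply: jetM; [exact: jet_cst|exact: eis_J].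
  by apply: jetB; apply: jetX; exact: eis_J.
- by rewrite hornerM hornerXn expr0n mulr0.
pose s t := 10 * G6 + 21 * G8 * t ^+ 2 - t ^+ 4 * v t.
pose r t := 5 * G6 + 7 * G8 * t ^+ 2 + t ^+ 4 * u t.
have hs : isO 0 s by rewrite /s; isO0_tac.
have hr : isO 0 r by rewrite /r; isO0_tac.
apply: (isO_ext _ (isOMX 4 (_ : isO 0 (fun t => 2 * v t - 3 * u t + 6 * G4 * s t
   + t ^+ 2 * s t ^+ 2 - 3 * G4 * r t - 3 * (t ^+ 2 * r t ^+ 2)
   - t ^+ 2 * (3 * G4 + t ^+ 2 * r t) ^+ 3)))); last by isO0_tac.
move=> t t0; rewrite hornerM hornerC hornerXn.
have -> : E 2 t = t ^- 2 + t ^+ 2 * (3 * G4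
  + t ^+ 2 * r t) by rewrite (e2 t t0) /r; ring.
have -> : E 3 t = t ^- 3 - t * (3 * G4 + t ^+ 2 * s t) by rewrite (e3 t t0) /s; ring.
(* After the poles cancel, [35 * G6 - (2 * s t + 3 * r t)] is what is left in low order; its
   constant term vanishes. *)
have e1 : 2 * s t + 3 * r t = 35 * G6 + 63 * G8 * t ^+ 2 - t ^+ 4 * (2 * v t - 3 * u t).
  by rewrite /r /s; ring.
have -> : t ^+ 4 * (2 * v t - 3 * u t + 6 * G4 * s t
  + t ^+ 2 * s t ^+ 2 - 3 * G4 * r t -
   3 * (t ^+ 2 * r t ^+ 2) - t ^+ 2 * (3 * G4 + t ^+ 2 * r t) ^+ 3) =
   35 * G6 + 63 * G8 * t ^+ 2 - (2 * s t + 3 * r t) +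
   t ^+ 4 * (6 * G4 * s t + t ^+ 2 * s t ^+ 2 - 3 * G4 * r t -
   3 * (t ^+ 2 * r t ^+ 2) - t ^+ 2 * (3 * G4 + t ^+ 2 * r t) ^+ 3).
  by rewrite e1; ring.
by move: (E 4 0) (E 6 0) (E 8 0) (r t) (s t) => g4 g6 g8 rt st; field.
Qed.

Lemma eis2_at z : ~ lat z -> exists2 u : C -> C, isO 0 u & forall t, t != 0 ->
  E 2 (z + t) = E 2 z - 2 * E 3 z * t + 3 * E 4 z * t ^+ 2 - 4 * E 5 z * t ^+ 3
     + 5 * E 6 z * t ^+ 4 - 6 * E 7 z * t ^+ 5 + t ^+ 6 * u t.
Proof.
move=> hz; have z0 : z != 0 by apply: contra_notN hz => /eqP ->; exact: lat0.
have [t|u hu e] := @eis_expand R A B An0 Bn0 2 5 z (fun=> 0) _ (or_intror hz) isT.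
  by rewrite (negPf z0).
exists u => // t t0; rewrite e//.
rewrite !big_ord_recl big_ord0 /= /bump /= !addnE /=.
rewrite (@negbin_val R 2 0 1)// (@negbin_val R 2 1 2)// (@negbin_val R 2 2 3)//
  (@negbin_val R 2 3 4)//
  (@negbin_val R 2 4 5)// (@negbin_val R 2 5 6)//.
ring.
Qed.

Lemma eis4_at z : ~ lat z -> exists2 u : C -> C, isO 0 u & forall t, t != 0 ->
  E 4 (z + t) = E 4 z - 4 * E 5 z * t + 10 * E 6 z * t ^+ 2 + t ^+ 3 * u t.
Proof.
move=> hz; have z0 : z != 0 by apply: contra_notN hz => /eqP ->; exact: lat0.
have [t|u hu e] := @eis_expand R A B An0 Bn0 4 2 z (fun=> 0) _ (or_intror hz) isT.
  by rewrite (negPf z0).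
exists u => // t t0; rewrite e//.
rewrite !big_ord_recl big_ord0 /= /bump /= !addnE /=.
rewrite (@negbin_val R 4 0 1)// (@negbin_val R 4 1 4)// (@negbin_val R 4 2 10)//.
ring.
Qed.

(** These are the first two derivatives of p'' = 6 p^2 - g2/2, read off by comparing the
    coefficients of [t] and [t ^+ 2]. *)
Lemma eis_higher z : ~ lat z -> E 5 z = E 2 z * E 3 z /\
  10 * E 6 z = 4 * E 3 z ^+ 2 + 6 * E 2 z * E 4 z.
Proof.
move=> hz; have [u hu e2] := eis2_at hz; have [v hv e4] := eis4_at hz.
have [d d0 hd] := lat_discrete z.
pose b t := v t - ((3 * E 4 z - 4 * E 5 z * t
  + 5 * E 6 z * t ^+ 2 - 6 * E 7 z * t ^+ 3 + t ^+ 4 * u t) ^+ 2 * t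
   - 4 * E 3 z * (3 * E 4 z - 4 * E 5 z * t
     + 5 * E 6 z * t ^+ 2 - 6 * E 7 z * t ^+ 3 + t ^+ 4 * u t)
   + 2 * E 2 z * (- 4 * E 5 z + 5 * E 6 z * t - 6 * E 7 z * t ^+ 2 + t ^+ 3 * u t)).
have hb : isO 0 b by rewrite /b; isO0_tac.
have [|h1 h2] := @isO_quad_eq0 R (- 4 * E 5 z + 4 * E 2 z * E 3 z)
  (10 * E 6 z - (4 * E 3 z ^+ 2 + 6 * E 2 z * E 4 z)) b d d0 hb.
  move=> t t0 td; have := wp_second_derivative (hd t t0 td).
  rewrite e2// e4// (wp_second_derivative hz) => /eqP; rewrite -subr_eq0 => /eqP h.
  by rewrite -[RHS]h /b (wp_second_derivative hz); ring.
split; last by apply/eqP; rewrite -subr_eq0; exact/eqP.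
have : 4 * (E 2 z * E 3 z - E 5 z) = 0 by rewrite -[RHS]h1; ring.
by move/eqP; rewrite mulf_eq0 pnatr_eq0 /= subr_eq0 => /eqP.
Qed.

End Elliptic.

(** * The relation between p, p' and p'' at a third of a period *)

Section ThreeTorsion.
Variables (R : realType) (A B : R).
Hypotheses (A0 : 0 < A) (B0 : 0 < B).
Local Notation C := R[i].
Local Notation E := (eis A (3 * B)).
Implicit Types (z t : C).
Let B30 : 0 < 3 * B. Proof. by rewrite mulr_gt0. Qed.
Let An0 : A != 0 := lt0r_neq0 A0.
Let Bn0 : 3 * B != 0 := lt0r_neq0 B30.
Local Notation a := (B *i : C).

Lemma torsion_notin_lat : ~ lat A (3 * B) a.
Proof.
move=> [i [j /eqP]]; rewrite eq_complex /= => /andP[_ /eqP].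
move=> /(congr1 (fun x => x / B)); rewrite mulrA mulfK ?lt0r_neq0// divff ?lt0r_neq0//.
have -> : j%:~R * 3 = (j * 3)%:~R :> R by rewrite intrM.
by rewrite -[1]/(1%:~R) => /eqP; rewrite eqr_int => /eqP; lia.
Qed.

Lemma lat_refine z : lat A (3 * B) z -> lat A B z.
Proof.
move=> [i [j ->]]; exists i, (j * 3); rewrite /om; congr (_ +i* _).
by rewrite intrM mulrA.
Qed.

Lemma torsion_in_lat : lat A B a.
Proof. by exists 0, 1; rewrite omB. Qed.

(* Here [3 * a] is a period, so the function [H] of the proof is invariant under
   [z |-> z + a]. Its double pole at [0] cancels, so it is constant; the relation is the
   vanishing of its [t^2] coefficient [q] at [0]. *)
Lemma torsion_relation : 3 * E 4 a ^+ 2 = 4 * E 2 a * E 3 a ^+ 2.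
Proof.
have [e5 e6] := eis_higher A0 B30 torsion_notin_lat.
have [v hv ev] := eis2_at A0 B30 torsion_notin_lat.
move: e5 e6 ev; set x := E 2 a; set e := E 3 a; set f := E 4 a.
set g := E 5 a; set h := E 6 a; set k := E 7 a => e5 e6 ev.
clearbody x e f g h k.
pose H z := E 2 z * E 2 (z + a) * E 2 (z - a)
  - x ^+ 2 * (E 2 z + E 2 (z + a) + E 2 (z - a)).
pose c := 6 * x * f - 4 * e ^+ 2 - 2 * x ^+ 3.
pose q := 10 * x * h + 9 * f ^+ 2 - 16 * e * g - 6 * x ^+ 2 * f.
have a3 : a + a + a = (3 * B) *i by apply/eqP; rewrite eq_complex /= !addr0 eqxx;
  apply/eqP; ring.
have HA z : H (z + A%:C) = H z.
  have e1 : z + A%:C + a = z + a + A%:C by rewrite addrAC.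
  have e2 : z + A%:C - a = z - a + A%:C by rewrite addrAC.
  by rewrite /H e1 e2 !eis_periodA.
have Ha z : H (z + a) = H z.
  have e1 : E 2 (z + a + a) = E 2 (z - a).
    have -> : z + a + a = (z - a) + (3 * B) *i by rewrite -a3; ring.
    by rewrite eis_periodB.
  by rewrite /H e1 addrK; ring.
have HJ z : ~ lat A B z -> has_jet 4 (fun t => H (z + t)).
  move=> hz; have J2 w : lat A B w -> has_jet 4 (fun t => E 2 (z + w + t)).
    move=> hw; apply: eis_J => // /lat_refine hw'; apply: hz.
    by rewrite -(addrK w z); apply: latD hw' _; exact: latN.
  have j0 := J2 _ (lat0 An0 (lt0r_neq0 B0)); rewrite addr0 in j0.
  have j1 := J2 _ torsion_in_lat; have j2 := J2 _ (latN torsion_in_lat).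
  have {}j1 : has_jet 4 (fun t => E 2 (z + t + a)) by apply: (jet_ext _ j1) => t;
    rewrite addrAC.
  have {}j2 : has_jet 4 (fun t => E 2 (z + t - a)) by apply: (jet_ext _ j2) => t;
    rewrite addrAC.
  apply: jetB; first by apply: jetM => //; exact: jetM.
  by apply: jetM; [exact: jet_cst|apply: jetD => //; exact: jetD].
have [u hu eu] := eis2_at0 A0 B30.
pose r t := 3 * E 4 0 + 5 * E 6 0 * t ^+ 2 + 7 * E 8 0 * t ^+ 4 + t ^+ 6 * u t.
have hr : isO 0 r by rewrite /r; isO0_tac.
have hv' : isO 0 (fun t => v (- t)) by exact: isO_opp.
(* Even and odd parts of the expansion at [a]. As p is even, [t - a] only changes the sign of the
   odd part, so the product below starts with even powers. *)
pose s1 t := 3 * f * t ^+ 2 + 5 * h * t ^+ 4.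
pose s2 t := 2 * e * t + 4 * g * t ^+ 3 + 6 * k * t ^+ 5.
have Pa t : t != 0 -> E 2 (t + a) = x + s1 t - s2 t + t ^+ 6 * v t.
  by move=> t0; rewrite addrC ev// /s1 /s2; ring.
have Pb t : t != 0 -> E 2 (t - a) = x + s1 t + s2 t + t ^+ 6 * v (- t).
  move=> t0; have -> : t - a = - (a + - t) by ring.
  rewrite eisN// sqrrN expr1n mul1r ev ?oppr_eq0// /s1 /s2; ring.
have hs1 : isO 0 s1 by rewrite /s1; isO0_tac.
have hs2 : isO 0 s2 by rewrite /s2; isO0_tac.
pose al := 6 * x * f - 4 * e ^+ 2.
pose be := 10 * x * h + 9 * f ^+ 2 - 16 * e * g.
have [W hW PW] : exists2 W : C -> C, isO 0 W & forall t, t != 0 ->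
    E 2 (t + a) * E 2 (t - a) = x ^+ 2 + (al * t ^+ 2 + be * t ^+ 4 + t ^+ 6 * W t).
  exists (fun t => 30 * f * h + 25 * h ^+ 2 * t ^+ 2 - (24 * e * k + 16 * g ^+ 2)
    - 48 * g * k * t ^+ 2 - 36 * k ^+ 2 * t ^+ 4
    + v (- t) * (x + s1 t - s2 t) + v t * (x + s1 t + s2 t) + t ^+ 6 * (v t * v (- t))).
    by clearbody s1 s2; isO0_tac.
  by move=> t t0; rewrite Pa// Pb// /al /be /s1 /s2; ring.
have hEr t : t != 0 -> E 2 t = t ^- 2 + t ^+ 2 * r t.
  by move=> t0; rewrite (eu t t0) /r; ring.
clearbody r.
have [Z hZ HZ] : exists2 Z : C -> C, isO 0 Z & forall t, t != 0 ->
    H t = c + q * t ^+ 2 + t ^+ 4 * Z t.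
  exists (fun t => W t + r t * (al + be * t ^+ 2 + t ^+ 4 * W t) - 10 * x ^+ 2 * h
    - x ^+ 2 * t ^+ 2 * (v t + v (- t))).
    by clearbody al be; isO0_tac.
  move=> t t0; rewrite /H -mulrA PW// Pa// Pb// hEr//.
  have -> : c = al - 2 * x ^+ 3 by [].
  have -> : q = be - 6 * x ^+ 2 * f by [].
  clear PW Pa Pb; clearbody al be; rewrite /s1 /s2.
  by move: (W t) (r t) (v t) (v (- t)) => W' r' v1 v2; field.
have Hc z : ~ lat A B z -> H z = c.
  (* Liouville's theorem is used on the finer lattice containing [a], modulo which [0], [a] and
     [- a] are one point. *)
  apply: (@liouville_elliptic R A B A0 B0 H c (c%:P + q%:P * 'X^2)) => //.
    by rewrite hornerD hornerM hornerXn !hornerC expr0n mulr0 addr0.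
  apply: (isO_ext _ (isOMX 4 hZ)) => t t0.
  by rewrite HZ// hornerD hornerM hornerXn !hornerC; ring.
have [d d0 hd] := lat_discrete A0 B0 0.
have hb : isO 0 (fun t => t * Z t) by isO0_tac.
have [|_ q0] := @isO_quad_eq0 R 0 q (fun t => t * Z t) d d0 hb.
  move=> t t0 td; have := Hc _ (hd t t0 td); rewrite add0r HZ// => h0.
  by apply: (eq_sub0 (p := c + q * t ^+ 2 + t ^+ 4 * Z t - c)); [rewrite h0 subrr|ring].
(* Substituting [g = x * e] and [10 * h = 4 * e ^+ 2 + 6 * x * f] turns [q] into
   [9 * f ^+ 2 - 12 * x * e ^+ 2]. *)
have : 3 * (3 * f ^+ 2 - 4 * x * e ^+ 2) = 0.
  rewrite -[RHS]q0 /q e5.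
  have -> : 10 * x * h = x * (10 * h) by ring.
  by rewrite e6; ring.
by move/eqP; rewrite mulf_eq0 pnatr_eq0 /= subr_eq0 => /eqP.
Qed.

End ThreeTorsion.

(** * The 3-division polynomial and the pole of d *)

Section Final.
Variable R : realType.
Local Notation C := R[i].

(* The relations say that [X] is a root of the 3-division polynomial, which here is
   [X + 1/3] times a cubic. With [w = (9 X - 1) / 4] and [r = sqrt (1 - m)] the cubic
   is [w^3 - 3 r^2 w - r^2 - r^4], which is negative for [w < 0]. *)
Lemma torsion_root (m X y G4 G6 : R) : 0 < m -> m < 1 ->
  60 * G4 = 4 / 27 * (9 - 8 * m) ->
  140 * G6 = 8 / 27 ^+ 2 * (8 * m ^+ 2 - 36 * m + 27) ->
  - y ^+ 2 = X ^+ 3 - 15 * G4 * X - 35 * G6 ->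
  3 * (X ^+ 2 - 5 * G4) ^+ 2 = - 4 * X * y ^+ 2 ->
  X = - 3^-1 /\ y != 0.
Proof.
move=> m0 m1 h4 h6 ode tor.
have {}h4 : G4 = (9 - 8 * m) / 405 by lra.
have {}h6 : 35 * G6 = 2 / 27 ^+ 2 * (8 * m ^+ 2 - 36 * m + 27) by lra.
(* If [y = 0], then [X] is a double root of 4 X^3 - g2 X - g3. The quantity in [e3] is the
   discriminant g2^3 - 27 g3^2 divided by 432. *)
have y0 : y != 0.
  apply/eqP => y0; move: ode tor; rewrite y0 expr0n mulr0 oppr0 => ode.
  move=> /eqP; rewrite mulf_eq0 pnatr_eq0 expf_eq0 /= => /eqP tor.
  have hX2 : X ^+ 2 = 5 * G4 by lra.
  have e1 : 2 * X * (5 * G4) = - 35 * G6.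
    have : X ^+ 3 = X * (5 * G4) by rewrite -hX2; ring.
    lra.
  have e2 : 4 * (5 * G4) ^+ 3 = (35 * G6) ^+ 2.
    have -> : (35 * G6) ^+ 2 = (2 * X * (5 * G4)) ^+ 2 by rewrite e1; ring.
    by rewrite -hX2; ring.
  have e3 : 4 * (5 * G4) ^+ 3 - (35 * G6) ^+ 2 = 256 / 729 ^+ 2 * (m ^+ 3 * (1 - m)).
    by rewrite h4 h6; field.
  have : 0 < m ^+ 3 * (1 - m) by rewrite mulr_gt0 ?exprn_gt0// subr_gt0.
  by move: e3; rewrite e2 subrr; lra.
split=> //.
have X0 : X <= 0.
  have y2 : 0 < y ^+ 2 by rewrite exprn_even_gt0.
  have : 0 <= (X ^+ 2 - 5 * G4) ^+ 2 by exact: sqr_ge0.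
  move=> h; rewrite leNgt; apply/negP => X0.
  by have := mulr_gt0 X0 y2; lra.
pose r := Num.sqrt (1 - m).
have r2 : r ^+ 2 = 1 - m by rewrite sqr_sqrtr// subr_ge0 ltW.
have r0 : 0 < r by rewrite sqrtr_gt0 subr_gt0.
have r1 : r < 1.
  by rewrite ltNge; apply/negP => r1; have := mulr_ege1 r1 r1; rewrite -expr2; lra.
pose w := (9 * X - 1) / 4.
have w0 : w < 0 by rewrite /w; lra.
have quart : (X + 3^-1) * (w ^+ 3 - 3 * r ^+ 2 * w - r ^+ 2 - r ^+ 4) = 0.
  have -> : r ^+ 4 = (1 - m) ^+ 2 by rewrite -r2; ring.
  rewrite r2 /w; have : 3 * (X ^+ 2 - 5 * G4) ^+ 2 = 4 * X * (X ^+ 3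
    - 15 * G4 * X - 35 * G6).
    by rewrite -ode tor; ring.
  rewrite h4 h6 => h; lra.
(* For [w < 0] the expression [w ^+ 3 - 3 * r ^+ 2 * w] is largest at [w = - r], with value
   [2 * r ^+ 3]; what remains is [- (r - r ^+ 2) ^+ 2], negative since [0 < r < 1]. *)
have neg : w ^+ 3 - 3 * r ^+ 2 * w - r ^+ 2 - r ^+ 4 < 0.
  have h1 : w ^+ 3 - 3 * r ^+ 2 * w <= 2 * r ^+ 3.
    have h : 0 <= (w + r) ^+ 2 * (2 * r - w) by rewrite mulr_ge0 ?sqr_ge0//; lra.
    have e : (w + r) ^+ 2 * (2 * r - w) = 2 * r ^+ 3 - (w ^+ 3
      - 3 * r ^+ 2 * w) by ring.
    by move: h; rewrite e; lra.
  have h2 : 0 < r ^+ 2 * (1 - r) ^+ 2 by rewrite mulr_gt0 ?exprn_gt0//; lra.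
  have e2 : r ^+ 2 * (1 - r) ^+ 2 = r ^+ 2 - 2 * r ^+ 3 + r ^+ 4 by ring.
  move: h2; rewrite e2; lra.
by move/eqP: quart; rewrite mulf_eq0 (lt_eqF neg) orbF addr_eq0 => /eqP.
Qed.

(** Passage from [box_cvg] to the topological limit. In the order of [R[i]] a positive [e] is real,
    so real tolerances suffice. *)
Lemma lattice_sumE (A B : R) (F : Cx R -> Cx R) (L : C) :
  box_cvg (fun i j => if om A B i j == 0 then 0 else F (om A B i j)) L ->
  lattice_sum A%:C (B%:C * 'i) F = L.
Proof.
move=> hL; apply: cvg_lim; first exact: norm_hausdorff.
apply/cvgrPdist_le => e e0.
have [er e0'] : e = (Re e)%:C /\ 0 < Re e.
  by case: (e) e0 => a b; rewrite ltcE /= => /andP[/eqP -> ?].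
have [N0 h] := hL _ e0'.
exists N0 => // N /= NN0; rewrite er distrC.
have -> : lattice_square_sum A%:C (B%:C * 'i) F N =
    box_sum N (fun i j => if om A B i j == 0 then 0 else F (om A B i j)).
  apply: eq_bigr => i _; apply: eq_bigr => j _.
  have -> : (i%:Z - N%:Z)%:~R * A%:C + (j%:Z - N%:Z)%:~R * (B%:C * 'i) =
    om A B (i%:Z - N%:Z) (j%:Z - N%:Z) :> C.
    rewrite !mulrzl; apply/eqP; rewrite eq_complex /= ReD ImD !(Re_mulz, Im_mulz) /=.
    by rewrite !mulr0 !mul0r !mulr1 !(subrr, subr0, addr0, add0r, mul0rz) !mulrzl !eqxx.
  by [].
by have := h N NN0; rewrite -lecR.
Qed.

End Final.

Unset Implicit Arguments.

(* d = 1 - (4/9) k^2 (p + 1/3)^{-1}, p the Weierstrass function with periods 2K, 2iK'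
   and invariants g2 = 4/27 (9 - 8k^2), g3 = 8/27^2 (8k^4 - 36k^2 + 27);
   then d has a pole at (2/3) i K'. *)
Theorem theorem2 (R : realType) (k K K' : R) :
  0 < k -> k < 1 -> 0 < K -> 0 < K' ->
  wp_g2 (2 * K)%:C ((2 * K')%:C * 'i)
    = ((4 / 27) * (9 - 8 * k ^+ 2))%:C ->
  wp_g3 (2 * K)%:C ((2 * K')%:C * 'i)
    = ((8 / 27 ^+ 2) * (8 * k ^+ 4 - 36 * k ^+ 2 + 27))%:C ->
  has_pole
    (fun z : Cx R =>
       1 - (((4 / 9) * k ^+ 2)%:C : Cx R)
           / (wp (2 * K)%:C ((2 * K')%:C * 'i) z + 3^-1))
    ((2 / 3 * K')%:C * 'i).
Proof.
move=> k0 k1 K0 K'0.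
pose A := 2 * K; pose B := 2 / 3 * K'.
have A0 : 0 < A by rewrite mulr_gt0.
have B0 : 0 < B by rewrite mulr_gt0// divr_gt0.
have B3 : 2 * K' = 3 * B by rewrite /B; field.
have B30 : 0 < 3 * B by rewrite mulr_gt0.
have An := lt0r_neq0 A0; have Bn := lt0r_neq0 B30.
rewrite -/A B3.
have even0 n (i j : int) : (1 < n)%N -> ~~ odd n -> n != 2%N ->
    eis_term A (3 * B) n 0 i j = (om A (3 * B) i j) ^- n.
  move=> n1 on n2; rewrite /eis_term (negPf n2) subr0 sub0r exprNn.
  by rewrite -signr_odd (negPf on) expr0 mul1r.
have L n : (1 < n)%N -> ~~ odd n -> n != 2%N ->
    lattice_sum A%:C ((3 * B)%:C * 'i) (fun om => (om ^+ n)^-1) = eis A (3 * B) n 0.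
  move=> n1 on n2; apply: lattice_sumE.
  apply: (eq_box_cvg _ (eisP An Bn 0 n1)) => N; apply: eq_box_sum => i j;
    rewrite even0//.
  by case: eqP => // ->; rewrite expr0n gtn_eqF ?invr0// ltnW.
rewrite /wp_g2 /wp_g3 L// L// => g2 g3.
have wpE z : wp A%:C ((3 * B)%:C * 'i) z = eis A (3 * B) 2 z.
  rewrite /wp (_ : lattice_sum _ _ _ = eis A (3 * B) 2 z - z ^- 2); first by ring.
  (* The origin contributes [z ^- 2] to [eis], whereas [lattice_sum] skips it. *)
  have hd : box_cvg (fun i j => if (i == 0) && (j == 0) then
    - z ^- 2 else 0) (- z ^- 2).
    by apply: box_cvg_cst => N; rewrite box_sum_delta.
  apply: lattice_sumE; apply: (eq_box_cvg _ (box_cvgD (eisP An Bn z (isT : (1 <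
    2)%N)) hd)) => N.
  apply: eq_box_sum => i j; rewrite -(om_inj0 An Bn) /eis_term /=.
  by case: eqP => [->|_]; rewrite ?addr0// expr0n invr0 !subr0 subrr.
pose a : R[i] := B *i.
have ha := torsion_notin_lat A0 B0; rewrite -/a in ha.
have aE : (2 / 3 * K')%:C * 'i = a :> R[i].
  by apply/eqP; rewrite eq_complex /= !(mulr0, mul0r, mulr1, subrr, addr0) !eqxx.
(* Combined with the parity of [eis], this makes [x] real and [e] purely imaginary. *)
have aJ : conjc a = - a by apply/eqP; rewrite eq_complex /= oppr0 !eqxx.
pose x := eis A (3 * B) 2 a; pose e := eis A (3 * B) 3 a.
have xJ : conjc x = x.
  by rewrite /x -(eis_conj An Bn)// aJ eisN// sqrrN expr1n mul1r.
have eJ : conjc e = - e.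
  by rewrite /e -(eis_conj An Bn)// aJ eisN// -signr_odd /= expr1 mulN1r.
have [X xE] : exists X : R, x = X%:C.
  exists (Re x); move: xJ; case: (x) => u v /= [] vv.
  by congr (_ +i* _); lra.
have [y eE] : exists y : R, e = y *i.
  exists (Im e); move: eJ; case: (e) => u v /= [] uu.
  by congr (_ +i* _); lra.
have [c4 c4E h4] : exists2 c4 : R, eis A (3 * B) 4 0 = c4%:C
  & 60 * c4 = 4 / 27 * (9 - 8 * k ^+ 2).
  exists (4 / 27 * (9 - 8 * k ^+ 2) / 60); last by field.
  have n60 : 60 != 0 :> R[i] by rewrite pnatr_eq0.
  by apply: (mulfI n60); rewrite g2; field.
have [c6 c6E h6] : exists2 c6 : R, eis A (3 * B) 6 0 = c6%:C &
    140 * c6 = 8 / 27 ^+ 2 * (8 * k ^+ 4 - 36 * k ^+ 2 + 27).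
  exists (8 / 27 ^+ 2 * (8 * k ^+ 4 - 36 * k ^+ 2 + 27) / 140); last by field.
  have n140 : 140 != 0 :> R[i] by rewrite pnatr_eq0.
  by apply: (mulfI n140); rewrite g3; field.
have e2E : e ^+ 2 = (- y ^+ 2)%:C.
  by rewrite eE; apply/eqP; rewrite eq_complex /=; apply/andP; split; apply/eqP; ring.
have ode : - y ^+ 2 = X ^+ 3 - 15 * c4 * X - 35 * c6.
  apply: complexI; rewrite -e2E /e (wp_ode A0 B30 ha) -/x xE c4E c6E; ring.
have tor : 3 * (X ^+ 2 - 5 * c4) ^+ 2 = - 4 * X * y ^+ 2.
  have t := torsion_relation A0 B0;
    rewrite -/a -/x -/e (wp_second_derivative A0 B30 ha) -/x in t.
  apply: complexI; transitivity (4 * x * e ^+ 2); last by rewrite e2E xE; ring.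
  by rewrite -t xE c4E; ring.
have [|||X3 y0] := @torsion_root R (k ^+ 2) X y c4 c6 _ _ h4 _ ode tor.
- by rewrite exprn_gt0.
- by rewrite expr_lt1// ltW.
- by rewrite h6; ring.
have e0 : 0 < nc e.
  by rewrite nc_gt0 eE eq_complex /= eqxx.
have [v hv ev] := eis2_at A0 B30 ha.
pose w t := 3 * eis A (3 * B) 4 a - 4 * eis A (3 * B) 5 a * t
  + 5 * eis A (3 * B) 6 a * t ^+ 2
  - 6 * eis A (3 * B) 7 a * t ^+ 3 + t ^+ 4 * v t.
have hw : isO 0 w by rewrite /w; isO0_tac.
(* Within [d] one has [nc (t * w t) <= nc e], so [nc (t * w t - 2 * e)] lies between [nc e] and
   [3 * nc e]. *)
have [d d0 hd] := isO_sub (isOM (isO_id R) hw) e0.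
pose D t := eis A (3 * B) 2 (a + t) + 3^-1.
have DE t : t != 0 -> D t = t * (t * w t - 2 * e).
  move=> t0; rewrite /D ev// -/x -/e xE X3 /w.
  have -> : (- 3^-1)%:C = - 3^-1 :> R[i] by rewrite rmorphN fmorphV rmorph_nat.
  ring.
have Dle t : t != 0 -> nc t < d -> 0 < nc (D t) <= 3 * nc e * nc t.
  move=> t0 td; rewrite DE// Normc.normcM.
  have n2 : nc (2 * e) = 2 * nc e by rewrite !mulr_natl normcMn.
  have := hd t t0 td; have := ncB (t * w t) (2 * e).
  have := ncB (t * w t) (t * w t - 2 * e); rewrite subKr n2.
  have nt : 0 < nc t by rewrite nc_gt0.
  move: (nc (t * w t)) (nc (t * w t - 2 * e)) => p q h1 h2 h3; apply/andP; split.
    by rewrite mulr_gt0//; lra.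
  by rewrite mulrC ler_wpM2r ?(ltW nt)//; lra.
pose c := 4 / 9 * k ^+ 2.
have c0 : 0 < c by rewrite mulr_gt0 ?exprn_gt0// divr_gt0.
move=> M; pose M1 := `|M| + 1.
have M10 : 0 < M1 by rewrite ltr_wpDl.
(* Then [nc (D t) < c / M1], so the quotient exceeds [|M| + 1]; the extra 1 absorbs the constant
   term of d. *)
pose d' := Num.min d (c / (3 * nc e * M1)).
have d'0 : 0 < d' by rewrite lt_min d0 divr_gt0// !mulr_gt0.
rewrite aE near_withinE; apply/nbhs_ballP; exists d'%:C; first by rewrite /= ltcR.
move=> z; rewrite -ball_normE /= => hz zn.
have za : z = a + (z - a) by rewrite addrC subrK.
have t0 : z - a != 0 by rewrite subr_eq0.
have za' : nc (z - a) < d' by rewrite nc_distC -ltcR.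
rewrite wpE za; move: (z - a) t0 za' => t t0 {z hz zn za}.
rewrite lt_min => /andP[td]; rewrite ltr_pdivlMr ?mulr_gt0// => tc.
have /andP[D0 D1] := Dle t t0 td.
rewrite -/(D t) -/c.
suff h : M <= nc (1 - c%:C / D t) by rewrite -lecR in h.
have := ncB 1 (1 - c%:C / D t);
  rewrite subKr Normc.normc1 Normc.normcM Normc.normcV nc_real gtr0_norm//.
have h1 : M1 <= c / nc (D t).
  rewrite ler_pdivlMr//; have := ler_wpM2l (ltW M10) D1.
  by move: tc; rewrite /M1; lra.
have := ler_norm M; move: h1; rewrite /M1; lra.
Qed.
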